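(* Let $c\ge 1$ be the fixed constant used in the choice of the prime $p$ below. The algorithm ''Algorithm 3'' described in the context is a bidirectional two-pass randomized streaming algorithm for $\mathrm{DYCK}(2)$ with space $O((\log n)^2)$ and time $\mathrm{polylog}(n)$. If the input belongs to $\mathrm{DYCK}(2)$ then the algorithm accepts it with probability $1$; otherwise it rejects it with probability at least $1-n^{-c}$.
   Context: $\mathrm{DYCK}(2)$ is the language of well-parenthesized words with two types of parentheses: over the alphabet $\{a,\bar a,b,\bar b\}$ it is the smallest language $L$ satisfying $L=\{\epsilon\}\cup aL\bar aL\cup bL\bar bL$. It also denotes the problem of deciding whether a given word is in the language. The letters $a,b$ are called upsteps and $\bar a,\bar b$ downsteps. A $k$-pass streaming algorithm with space $s(n)$ and time $t(n)$ is an algorithm such that for every input stream $x=x_1x_2\ldots x_n$: (1) it performs $k$ sequential passes on $x$, the letters arriving one by one; (2) it maintains a memory space of size $s(n)$ while reading $x$; (3) it has running time at most $t(n)$ per letter $x_i$; (4) it has preprocessing and postprocessing time $t(n)$. It is bidirectional if it is allowed to access the input in the reverse order after reaching the end of the input; then $k$ is the total number of passes in either direction. The length $n$ is given to the algorithm in advance. Hashing. For a word $x$, $\mathrm{height}(x)=|x|_a+|x|_b-|x|_{\bar a}-|x|_{\bar b}$, where $|x|_l$ is the number of occurrences of the letter $l$; $x[1,i]$ is the prefix of length $i$. Let $p$ be a prime with $n^{1+c}\le p<2n^{1+c}$, and let $\alpha$ be a uniformly random integer in $[0,p-1]$; probabilities are over $\alpha$. For a letter at position $i$ of $x$, $\mathrm{hash}(x_i)=\alpha^{\mathrm{height}(x[1,i])}\bmod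 p$ if $x_i=a$, $\mathrm{hash}(x_i)=-\alpha^{\mathrm{height}(x[1,i-1])}\bmod p$ if $x_i=\bar a$, and $\mathrm{hash}(x_i)=0$ otherwise. For a subsequence $v=x_{i_1}x_{i_2}\ldots x_{i_m}$, $\mathrm{hash}(v)=\sum_j\mathrm{hash}(x_{i_j})$ (modulo $p$). The algorithm keeps track of the height of the word read so far. $\mathrm{first}(v)$ is the index of the first letter of $v$. Algorithm 3. Let $k=\lceil\log n\rceil$ (base $2$). Without loss of generality $n=2^k$: an input of odd length is not in $\mathrm{DYCK}(2)$, and an input of even length is padded by appending a word $(a\bar a)^i$ of suitable length (the number of added letters being stored). For each $i$, an $i$-block is a substring $x[(q-1)2^i+1,\,q2^i]$ with $1\le q\le n/2^i$. - Start with an empty stack $S$. - Run the procedure $\mathrm{Block}(k,S)$ below, reading the stream from left to right. - If $S$ is not empty, reject. - Run $\mathrm{Block}(k,S)$ reading the stream from right to left; in this pass the letters $\bar a,\bar b$ are interpreted as $a,b$ respectively, and vice versa. - If no rejection occurred, accept. Procedure $\mathrm{Block}(i,S)$, which reads the $2^i$ letters of an $i$-block $B_i$. Each stack item is a triple $(h,\ell,f)$ encoding a subsequence $v$ of the stream, with $h=\mathrm{hash}(v)$, $\ell=\mathrm{height}(v)$, $f=\mathrm{first}(v)$. - Do the following twice. If $i>1$, call $\mathrm{Block}(i-1,S)$. If $i=1$, read one letter $y$. If $y$ is an upstep, push $(\mathrm{hash}(y),1,\mathrm{first}(y))$ on $S$. If $y$ is a downstep: pop $(h,\ell,f)$ from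 $S$ (reject if $S$ is empty), set $\ell\leftarrow\ell-1$ and $h\leftarrow h+\mathrm{hash}(y)$, push $(h,\ell,f)$ on $S$; then, if $\ell=0$, check that $h=0$ (reject if not), and pop and discard this item. - Afterwards, if $S$ has at the top two items whose first letters are in $B_i$, pop $(h_2,\ell_2,f_2)$, then pop $(h_1,\ell_1,f_1)$, and push $(h_1+h_2,\ell_1+\ell_2,f_1)$ on $S$. *)

(* Defs.v *)
(* MathComp / MathComp-Analysis. *)
From HB Require Import structures.
From mathcomp Require Import all_boot all_order all_algebra.
From mathcomp Require Import all_classical all_reals all_analysis.

Set Implicit Arguments.
Unset Strict Implicit.
Unset Printing Implicit Defensive.

Import Order.TTheory GRing.Theory Num.Theory numFieldNormedType.Exports.

Local Open Scope nat_scope.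

(** * Words and DYCK(2) *)

(* [La], [Lb] are the upsteps a, b; [La'], [Lb'] the downsteps. *)
Variant letter := La | La' | Lb | Lb'.

Definition letter_code (y : letter) : nat :=
  match y with La => 0 | La' => 1 | Lb => 2 | Lb' => 3 end.

Definition letter_decode (c : nat) : letter :=
  match c with 0 => La | 1 => La' | 2 => Lb | _ => Lb' end.

Lemma letter_codeK : cancel letter_code letter_decode.
Proof. by case. Qed.

HB.instance Definition _ := Equality.copy letter (can_type letter_codeK).

Definition upstep (y : letter) : bool := (y == La) || (y == Lb).

Definition flip (y : letter) : letter :=
  match y with La => La' | La' => La | Lb => Lb' | Lb' => Lb end.

Definition word := seq letter.

Inductive dyck2 : word -> Prop :=
| dyck2_nil : dyck2 [::]
| dyck2_a u v : dyck2 u -> dyck2 v -> dyck2 (La :: u ++ La' :: v)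
| dyck2_b u v : dyck2 u -> dyck2 v -> dyck2 (Lb :: u ++ Lb' :: v).

(** * Hashing *)

Definition height (x : word) : int :=
  ((count_mem La x)%:Z + (count_mem Lb x)%:Z
   - (count_mem La' x)%:Z - (count_mem Lb' x)%:Z)%R.

(* Residues modulo the prime [p] are elements of ['F_p].  Positions are
   1-based.  The integer exponent is never negative where the algorithm uses
   the hash, since it rejects on an empty stack. *)
Definition hash (p alpha : nat) (x : word) (i : nat) : 'F_p :=
  match onth x i.-1 with
  | Some La => (alpha%:R ^ height (take i x))%R
  | Some La' => (- alpha%:R ^ height (take i.-1 x))%R
  | _ => 0%R
  end.

(** * The algorithm *)

(* The triple (h, l, f) of hash, height and first index; the top of the stack
   is the head of the list. *)
Definition item (p : nat) : Type := ('F_p * int * nat)%type.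
Definition stack (p : nat) := seq (item p).

(* The procedures run on the prefix of the stream that has arrived so far.
   [Waiting st] means that the next letter has been requested but has not
   arrived, and [Done pos st] that the call returned after [pos] letters in all
   had been read; [st] is the current stack.  On a complete stream [Waiting]
   does not occur. *)
Inductive status (p : nat) :=
| Rejected
| Waiting of stack p
| Done of nat & stack p.
Arguments Rejected {p}.

Definition andThen p (r : status p) (f : nat -> stack p -> status p) :=
  if r is Done pos st then f pos st else r.

Definition read_letter (p alpha : nat) (x : word) (pos : nat) (st : stack p) :
    status p :=
  match onth x pos with
  | None => Waiting st
  | Some y =>
    let i := pos.+1 in
    let hy := hash p alpha x i in
    if upstep y then Done i ((hy, 1%R, i) :: st)
    else if st is (h, l, f) :: st' then
      let l' := (l - 1)%R in
      let h' := (h + hy)%R in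
      if l' == 0%R then
        if h' == 0%R then Done i st' else Rejected
      else Done i ((h', l', f) :: st')
    else Rejected
  end.

(* The block consists of the positions [start + 1], ..., [start + 2 ^ i]. *)
Definition merge_top (p i start : nat) (st : stack p) : stack p :=
  let in_block f := start < f <= start + 2 ^ i in
  if st is (h2, l2, f2) :: (h1, l1, f1) :: st' then
    if in_block f1 && in_block f2
    then ((h1 + h2)%R, (l1 + l2)%R, f1) :: st'
    else st
  else st.

(* [Block] is only meant to be called with [0 < i]. *)
Fixpoint Block (p alpha : nat) (x : word) (i start : nat) (st : stack p) :
    status p :=
  if i is i'.+1 then
    let body := if i' is 0 then read_letter alpha x else Block alpha x i' in
    andThen (body start st) (fun pos1 st1 =>
    andThen (body pos1 st1) (fun pos2 st2 =>
    Done pos2 (merge_top i start st2)))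
  else Done start st.

Definition levels (n : nat) : nat := up_log 2 n.

(* number of letters appended to an input of even length [n] *)
Definition npad (n : nat) : nat := 2 ^ levels n - n.

Definition padded (x : word) : word :=
  x ++ flatten (nseq (npad (size x))./2 [:: La; La']).

(* the stream as interpreted in the right-to-left pass *)
Definition mirrored (x : word) : word := map flip (rev (padded x)).

(* Outcome of either pass when only the first [j] letters of the padded stream
   have arrived. *)
Definition pass1 (p alpha : nat) (x : word) (j : nat) : status p :=
  Block alpha (take j (padded x)) (levels (size x)) 0 [::].

Definition pass2 (p alpha : nat) (x : word) (j : nat) : status p :=
  Block alpha (take j (mirrored x)) (levels (size x)) 0 [::].

Definition pass1_ok (p alpha : nat) (x : word) : bool :=
  if pass1 p alpha x (2 ^ levels (size x)) is Done _ [::] then true else false.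

Definition pass2_ok (p alpha : nat) (x : word) : bool :=
  if pass2 p alpha x (2 ^ levels (size x)) is Done _ _ then true else false.

Definition algorithm3 (p alpha : nat) (x : word) : bool :=
  [&& ~~ odd (size x), pass1_ok p alpha x & pass2_ok p alpha x].

(** * Streaming algorithms *)

(* The machine is a random access machine with logarithmic costs: a fixed
   program works on finitely many registers and one pushdown of natural
   numbers written in binary.  Every operation is charged its schoolbook bit
   cost, and the memory in use is the number of bits held. *)

Definition bits (v : nat) : nat := (trunc_log 2 v).+1.

Variant operand := Cst of nat | Reg of nat.

Variant binop := Add | Sub | Mul | Div | Mod.

Variant test := TestEq of operand & operand | TestLt of operand & operand
              | TestEmpty.

Inductive cmd :=
| Skip
| Op of nat & binop & operand & operand
| Push of operand
| Pop of nat
| Seq of cmd & cmd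
| If of test & cmd & cmd
| While of test & cmd.

Record memory := Memory { regs : seq nat; pushdown : seq nat }.

Definition memory_size (m : memory) : nat :=
  \sum_(v <- regs m ++ pushdown m) bits v.

Definition get (m : memory) (r : nat) : nat := nth 0 (regs m) r.

Definition put (m : memory) (r v : nat) : memory :=
  Memory (set_nth 0 (regs m) r v) (pushdown m).

Definition value (m : memory) (o : operand) : nat :=
  match o with Cst v => v | Reg r => get m r end.

Definition eval_op (o : binop) (v w : nat) : nat :=
  match o with
  | Add => v + w | Sub => v - w | Mul => v * w | Div => v %/ w | Mod => v %% w
  end.

Definition op_cost (o : binop) (v w : nat) : nat :=
  match o with
  | Add | Sub => bits v + bits w
  | Mul | Div | Mod => bits v * bits w
  end.

Definition eval_test (m : memory) (b : test) : bool :=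
  match b with
  | TestEq v w => value m v == value m w
  | TestLt v w => value m v < value m w
  | TestEmpty => nilp (pushdown m)
  end.

Definition test_cost (m : memory) (b : test) : nat :=
  match b with
  | TestEq v w | TestLt v w => bits (value m v) + bits (value m w)
  | TestEmpty => 1
  end.

Definition push (m : memory) (v : nat) : memory :=
  Memory (regs m) (v :: pushdown m).

Definition pop (m : memory) (r : nat) : memory :=
  Memory (set_nth 0 (regs m) r (head 0 (pushdown m))) (behead (pushdown m)).

(* [exec c m m' t s]: started in [m], the command [c] halts in [m'] after time
   [t], and the largest memory size met on the way is [s]. *)
Inductive exec : cmd -> memory -> memory -> nat -> nat -> Prop :=
| exec_skip m : exec Skip m m 1 (memory_size m)
| exec_op r o v w m :
    let m' := put m r (eval_op o (value m v) (value m w)) in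
    exec (Op r o v w) m m' (op_cost o (value m v) (value m w))
      (maxn (memory_size m) (memory_size m'))
| exec_push v m :
    let m' := push m (value m v) in
    exec (Push v) m m' (bits (value m v))
      (maxn (memory_size m) (memory_size m'))
| exec_pop r m :
    let m' := pop m r in
    exec (Pop r) m m' (bits (head 0 (pushdown m)))
      (maxn (memory_size m) (memory_size m'))
| exec_seq c d m m1 m2 t1 t2 s1 s2 :
    exec c m m1 t1 s1 -> exec d m1 m2 t2 s2 ->
    exec (Seq c d) m m2 (t1 + t2) (maxn s1 s2)
| exec_if b c d m m' t s :
    exec (if eval_test m b then c else d) m m' t s ->
    exec (If b c d) m m' (test_cost m b + t) s
| exec_while_end b c m :
    ~~ eval_test m b -> exec (While b c) m m (test_cost m b) (memory_size m)
| exec_while_step b c m m1 m2 t1 t2 s1 s2 :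
    eval_test m b -> exec c m m1 t1 s1 -> exec (While b c) m1 m2 t2 s2 ->
    exec (While b c) m m2 (test_cost m b + t1 + t2) (maxn s1 s2).

Definition exec_within (t s : nat) (c : cmd) (m m' : memory) : Prop :=
  exists t' s', [/\ exec c m m' t' s', t' <= t & s' <= s].

Variant direction := LeftToRight | RightToLeft.

(* [on_letter] is run on the arrival of each letter and [at_end] after the last
   letter of the pass; [at_end] of the last pass is the postprocessing. *)
Record pass := Pass { dir : direction; on_letter : cmd; at_end : cmd }.

Record streaming_program := StreamingProgram {
  preprocess : cmd;
  passes : seq pass }.

(* Register conventions: 0, 1, 2 initially hold [n], [p], [alpha]; each letter
   is delivered in register 3; register 4 holds the verdict. *)
Definition initial_memory (n p alpha : nat) : memory :=
  Memory [:: n; p; alpha] [::].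

Definition deliver (m : memory) (y : letter) : memory := put m 3 (letter_code y).

Definition accepting (m : memory) : bool := get m 4 == 1.

(* [feed t s c m w ms]: [ms] lists the memories reached from [m] after each
   letter of [w]. *)
Inductive feed (t s : nat) (c : cmd) :
    memory -> word -> seq memory -> Prop :=
| feed_nil m : feed t s c m [::] [::]
| feed_cons m y w m1 ms :
    exec_within t s c (deliver m y) m1 -> feed t s c m1 w ms ->
    feed t s c m (y :: w) (m1 :: ms).

(* [run_passes t s x Ps m tr m']: running the passes [Ps] on the input [x] leads
   from [m] to [m']; for each pass, [tr] records the memory before its first
   letter and after each letter. *)
Inductive run_passes (t s : nat) (x : word) :
    seq pass -> memory -> seq (seq memory) -> memory -> Prop :=
| run_passes_nil m : run_passes t s x [::] m [::] m
| run_passes_cons P Ps m ms m1 tr m2 :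
    feed t s (on_letter P) m (if dir P is LeftToRight then x else rev x) ms ->
    exec_within t s (at_end P) (last m ms) m1 ->
    run_passes t s x Ps m1 tr m2 ->
    run_passes t s x (P :: Ps) m ((m :: ms) :: tr) m2.

Definition run (M : streaming_program) (t s p alpha : nat) (x : word)
    (tr : seq (seq memory)) (m' : memory) : Prop :=
  exists2 m, exec_within t s (preprocess M) (initial_memory (size x) p alpha) m
           & run_passes t s x (passes M) m tr m'.

(* [good n p] is the requirement on the modulus for inputs of length [n]. *)
Definition streaming_algorithm (dirs : seq direction) (good : nat -> nat -> Prop)
    (M : streaming_program) (s t : nat -> nat) : Prop :=
  map dir (passes M) = dirs /\
  forall (x : word) (p alpha : nat), good (size x) p -> alpha < p ->
    exists tr m', run M (t (size x)) (s (size x)) p alpha x tr m'.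

(** * Programs that carry out the algorithm *)

Definition encode_stack (p : nat) (st : stack p) : seq nat :=
  flatten [seq [:: nat_of_ord it.1.1; `|it.1.2|%N; it.2] | it <- st].

Definition holds_stack (p : nat) (r : status p) (m : memory) : Prop :=
  match r with
  | Rejected => True
  | Waiting st | Done _ st => pushdown m = encode_stack st
  end.

(* As long as the algorithm has not rejected, the pushdown of [M] holds its
   stack after every letter of either pass, and the verdicts agree.  The padding
   is not part of the input of [M]: it is still to come after the [size x]
   letters of the first pass, and it precedes those of the second pass. *)
Definition implements_algorithm3 (good : nat -> nat -> Prop)
    (M : streaming_program) : Prop :=
  forall (x : word) (p alpha t s : nat) (tr : seq (seq memory)) (m' : memory),
    good (size x) p -> alpha < p -> run M t s p alpha x tr m' ->
    let snap k j := nth m' (nth [::] tr k) j in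
    [/\ ~~ odd (size x) -> forall j, j <= size x ->
          holds_stack (pass1 p alpha x j) (snap 0 j),
        ~~ odd (size x) -> pass1_ok p alpha x -> forall j, j <= size x ->
          holds_stack (pass2 p alpha x (npad (size x) + j)) (snap 1 j) &
        accepting m' = algorithm3 p alpha x].

(** * Bounds and probabilities *)

Local Open Scope ring_scope.

Definition good_modulus (R : realType) (c : R) (n p : nat) : Prop :=
  prime p /\ n%:R `^ (1 + c) <= p%:R < 2 * n%:R `^ (1 + c).

(* probability over a uniformly random integer in [0, p - 1] *)
Definition Prob (R : realType) (p : nat) (E : pred nat) : R :=
  #|[set alpha : 'I_p | E alpha]|%:R / p%:R.

Definition log2 (R : realType) (n : nat) : R := ln n%:R / ln 2.

(* Main.v *)
(* Unmatched letters of a block form a word D of downsteps followed by a word U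
   of upsteps.  When the algorithm reads a block, it applies D to the old stack
   and leaves one new item, the hash of U.  Suppose that all pairs inside the two
   halves of a block match, and let U be the unmatched upsteps of the first half,
   D the unmatched downsteps of the second one.  If |U| <= |D|, the item of the
   first half is emptied, hence checked, inside the second half before any
   merging; its letters pair up at pairwise distinct heights, so a mismatch makes
   its hash a nonzero polynomial in alpha.  If |U| > |D|, the same happens in the
   reverse pass.  So a word outside DYCK(2) fails the check of a fixed nonzero
   polynomial of degree at most n, which has at most n roots modulo p.

   The stack has at most one item per level of the current block and the items
   have O(log n) bits.  The program recomputes alpha^height for each letter by
   repeated squaring. *)
Require Import Defs.
From mathcomp Require Import all_boot all_order all_algebra.
From mathcomp Require Import all_classical all_reals all_analysis.
From mathcomp Require Import ring lra zify.

Set Implicit Arguments.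
Unset Strict Implicit.
Unset Printing Implicit Defensive.

Import Order.TTheory GRing.Theory Num.Theory numFieldNormedType.Exports.

Local Open Scope nat_scope.

(** * Reduction of words *)

(** A check is reached only if all earlier ones passed, so the polynomial that a bad input meets
    seems to depend on [alpha]. Running the same algorithm over [{poly 'F_p}] at ['X] removes this
    dependence. Up to the first check that fails there, every check is of the zero polynomial and
    passes at every residue, so the run at a residue is the evaluation of the polynomial run, and
    the failing check provides the fixed polynomial.

    Its degree is bounded by the number of upsteps of the padded word. For a balanced word this is
    half the padded length, hence less than [n] even when the padded length is close to [2 * n]; so
    [n / p] is at most [n ^ (- c)] with no extra factor.

    The recursion [Block] is unrolled into a run [grun] over single letters, where the merges after
    a letter are read off the 2-adic valuation of its position. This form fits incomplete streams
    and a machine without recursion. *)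

Lemma flipK : involutive flip.
Proof. by case. Qed.

Lemma upstep_flip y : upstep (flip y) = ~~ upstep y.
Proof. by case: y. Qed.

Definition mirror (w : word) : word := map flip (rev w).

Lemma mirror_cat u v : mirror (u ++ v) = mirror v ++ mirror u.
Proof. by rewrite /mirror rev_cat map_cat. Qed.

Lemma size_mirror w : size (mirror w) = size w.
Proof. by rewrite size_map size_rev. Qed.

(** As [U] has its last upstep first, the heads of both lists are the two letters nearest to the
    junction. *)
Fixpoint cancel_steps (U D : word) : option (word * word) :=
  match U, D with
  | [::], _ => Some ([::], D)
  | _, [::] => Some (U, [::])
  | u :: U', d :: D' => if flip u == d then cancel_steps U' D' else None
  end.

Definition reduce_step (a : option (word * word)) (y : letter) :=
  obind (fun DU : word * word =>
    let (D, U) := DU in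
    if upstep y then Some (D, y :: U)
    else if U is u :: U' then if flip u == y then Some (D, U') else None
    else Some (rcons D y, [::])) a.

(* [Some (D, U)] are the unmatched downsteps in order of occurrence and the
   unmatched upsteps, last one first; [None] reports a pair of matching letters
   of different types. *)
Definition reduce (w : word) : option (word * word) :=
  foldl reduce_step (Some ([::], [::])) w.

(** This is the product of the polycyclic monoid on two generators, with [None] as its zero;
    [reduce] is the morphism from words into it. *)
Definition glue (a b : option (word * word)) : option (word * word) :=
  obind (fun DU1 : word * word => obind (fun DU2 : word * word =>
    omap (fun r : word * word => (DU1.1 ++ r.2, DU2.2 ++ r.1))
      (cancel_steps DU1.2 DU2.1)) b) a.

Lemma cancel_steps_nil U : cancel_steps U [::] = Some (U, [::]).
Proof. by case: U. Qed.

Lemma cancel_steps_one_empty U D u d :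
  cancel_steps U D = Some (u, d) -> u = [::] \/ d = [::].
Proof.
elim: U D => [|u0 U IH] [|d0 D] /=; [by move=> [<- _]; left | by move=> [<- _]; left
  | by move=> [_ <-]; right |].
by case: ifP => // _ /IH.
Qed.

Lemma cancel_steps_rcons U D y :
  cancel_steps U (rcons D y) =
  obind (fun r : word * word => if r.1 is u :: U' then
      if flip u == y then Some (U', [::]) else None
    else Some ([::], rcons r.2 y)) (cancel_steps U D).
Proof.
elim: U D => [|u0 U IH] [|d0 D] //=; last by case: ifP.
by rewrite cancel_steps_nil.
Qed.

Lemma glue_step a b y : glue a (reduce_step b y) = reduce_step (glue a b) y.
Proof.
case: a b => [[D1 U1]|] [[D2 U2]|] //=.
case: ifP => Hy.
  by rewrite /=; case: cancel_steps => [[u d]|] //=; rewrite Hy.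
case: U2 => [|u U2] /=.
  rewrite cancel_steps_rcons; case E: cancel_steps => [[u d]|] //=.
  rewrite Hy; case: u E => [|u0 u] /= E; first by rewrite rcons_cat.
  by case: (cancel_steps_one_empty E) => // ->; case: ifP.
case: ifP => Hu /=; case E: cancel_steps => [[u1 d1]|] //=;
  by rewrite Hy Hu.
Qed.

Lemma glue_nil a : glue a (Some ([::], [::])) = a.
Proof. by case: a => [[D U]|] //=; rewrite cancel_steps_nil /= cats0. Qed.

Lemma reduce_rcons w y : reduce (rcons w y) = reduce_step (reduce w) y.
Proof. by rewrite /reduce -cats1 foldl_cat. Qed.

Lemma reduce_cat u v : reduce (u ++ v) = glue (reduce u) (reduce v).
Proof.
elim/last_ind: v => [|v y IH]; first by rewrite cats0 glue_nil.
by rewrite -rcons_cat !reduce_rcons IH -glue_step.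
Qed.

Definition flip_ends (DU : word * word) := (map flip DU.2, map flip DU.1).

Lemma reduce_mirror w : reduce (mirror w) = omap flip_ends (reduce w).
Proof.
elim: w => // y w IH.
rewrite -[y :: w]cat1s mirror_cat cats1 reduce_rcons IH reduce_cat.
have ->: reduce [:: y] = if upstep y then Some ([::], [:: y]) else Some ([:: y], [::]) by [].
rewrite /reduce_step; case: (reduce w) => [[D U]|]; last by case: ifP.
rewrite [LHS]/= upstep_flip; case Hy: (upstep y) => /=; last by rewrite cats0.
case: D => [|d D] /=; first by rewrite /flip_ends cats1 map_rcons.
rewrite (inj_eq (inv_inj flipK)) -{2}(flipK d) (inj_eq (inv_inj flipK)) eq_sym.
by case: eqP => //= _; rewrite /flip_ends cats0.
Qed.

Lemma reduce_letters w D U : reduce w = Some (D, U) ->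
  all (predC upstep) D && all upstep U.
Proof.
elim/last_ind: w D U => [|w y IH] D U; first by move=> [<- <-].
rewrite reduce_rcons.
case: (reduce w) IH => [[D' U']|] //= /(_ _ _ erefl)/andP[HD HU].
case: ifP => Hy; first by move=> [<- <-] /=; rewrite HD Hy.
case: U' HU => [|u U'] /= HU; first by move=> [<- <-]; rewrite all_rcons /= Hy HD.
by case: ifP => // _ [<- <-]; rewrite HD; case/andP: HU.
Qed.

Lemma reduce_dyck2 x : dyck2 x -> reduce x = Some ([::], [::]).
Proof.
elim=> // u v _ Hu _ Hv; by
 rewrite -[_ :: _]cat1s -cat_rcons -cats1 -catA !reduce_cat Hu Hv.
Qed.

(** Generalizes [dyck2] to a word read with upsteps [U] still open, so that [reduce_closes] can go
    by induction on the word. *)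
Fixpoint closes (U x : word) : Prop :=
  if U is u :: U' then
    exists v x', [/\ x = v ++ flip u :: x', dyck2 v & closes U' x']
  else dyck2 x.

Lemma reduce_closes x U : foldl reduce_step (Some ([::], U)) x = Some ([::], [::]) ->
  all upstep U -> closes U x.
Proof.
have none w : foldl reduce_step None w = None by elim: w.
(* An unmatched downstep is never removed by later letters. *)
have junk w d D U' : foldl reduce_step (Some (d :: D, U')) w <> Some ([::], [::]).
  elim: w d D U' => //= y w IH d D U'; case: ifP => _; first exact: IH.
  by case: U' => [|u U']; [exact: IH | case: ifP => _; [exact: IH | rewrite none]].
elim: x U => [|y x IH] U /=; first by move=> [->] _; constructor.
case: ifP => Hy.
  move=> /IH + HU; rewrite /= Hy HU => /(_ isT) [v [x' [-> Hv]]].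
  have wrap v' : dyck2 v' -> dyck2 (y :: v ++ flip y :: v').
    by case: (y) Hy => // _ Hv'; constructor.
  case: U HU => [|u U] _ /=; first exact: wrap.
  move=> [v' [x'' [-> Hv' Hc]]]; exists (y :: v ++ flip y :: v'), x''; split=> //.
    by rewrite /= -catA.
  exact: wrap.
case: U => [|u U] /=; first by move=> /junk.
case: eqP => [<-|]; last by rewrite none.
move=> /IH H /andP[_ /H Hc]; exists [::], x; split=> //; constructor.
Qed.

Lemma dyck2_reduce x : reduce x = Some ([::], [::]) <-> dyck2 x.
Proof. by split; [move=> /reduce_closes; apply | exact: reduce_dyck2]. Qed.

Lemma dyck2_even x : dyck2 x -> ~~ odd (size x).
Proof.
by elim=> // u v _ + _; rewrite /= !size_cat /= addnS /= oddD negbK; case: odd; case: odd.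
Qed.

Lemma reduce_pads x m :
  reduce (x ++ flatten (nseq m [:: La; La'])) = reduce x.
Proof.
rewrite reduce_cat; have ->: reduce (flatten (nseq m [:: La; La'])) = Some ([::], [::]).
  by elim: m => //= m IH; rewrite -[_ :: _](cat1s _ (_ :: _)) -[La' :: _]cat1s catA
    reduce_cat IH.
exact: glue_nil.
Qed.

(** * The algorithm over a ring *)

(* Stacks of the algorithm over an arbitrary ring, with a generic point [al] in
   place of the random residue: over ['F_p] this is the algorithm itself, and
   over [{poly 'F_p}] at ['X] all random choices are treated at once. *)
Definition gstack (R : Type) := seq (R * nat * nat).

(** In a run from the empty stack that has not failed, this is the height of the word read
    ([hgt_grun]), so hashes can be computed from the stack alone. *)
Definition hgt (R : Type) (st : gstack R) : nat := sumn [seq it.1.2 | it <- st].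

(** [H] is the height before the letter, so an upstep and the downstep closing it get the same
    exponent and opposite signs. *)
Definition hash_at (R : nzRingType) (al : R) (H : nat) (y : letter) : R :=
  match y with La => al ^+ H.+1 | La' => - al ^+ H | _ => 0 end%R.

Definition gdown (R : nzRingType) (al : R) (st : gstack R) (y : letter) :
    option (gstack R) :=
  if st is (h, l, f) :: st' then
    let h' := (h + hash_at al (hgt st) y)%R in
    if l.-1 == 0 then if h' == 0%R then Some st' else None
    else Some ((h', l.-1, f) :: st')
  else None.

Definition gread (R : nzRingType) (al : R) (pos : nat) (st : gstack R)
    (y : letter) : option (gstack R) :=
  if upstep y then Some ((hash_at al (hgt st) y, 1, pos.+1) :: st)
  else gdown al st y.

Definition gmerge (R : nzRingType) (i start : nat) (st : gstack R) : gstack R :=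
  let in_block f := start < f <= start + 2 ^ i in
  if st is (h2, l2, f2) :: (h1, l1, f1) :: st' then
    if in_block f1 && in_block f2
    then ((h1 + h2)%R, l1 + l2, f1) :: st'
    else st
  else st.

(** The blocks ending at position [pos] are those whose level [j] satisfies [2 ^ j %| pos], that is
    [j <= logn 2 pos]. Inner blocks return first, hence the increasing order; [i] is the level of
    the outermost call. *)
Definition merges (R : nzRingType) (i pos : nat) (st : gstack R) : gstack R :=
  foldl (fun s j => gmerge j (pos - 2 ^ j) s) st (iota 1 (minn i (logn 2 pos))).

Fixpoint grun (R : nzRingType) (al : R) (i pos : nat) (st : gstack R) (w : word) :
    option (gstack R) :=
  if w is y :: w' then
    obind (fun s => grun al i pos.+1 (merges i pos.+1 s) w') (gread al pos st y)
  else Some st.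

Lemma grun_cat (R : nzRingType) (al : R) i pos st u v :
  grun al i pos st (u ++ v) =
  obind (fun s => grun al i (pos + size u) s v) (grun al i pos st u).
Proof.
elim: u pos st => [|y u IH] pos st /=; first by rewrite addn0.
by case: gread => //= s; rewrite IH addSnnS.
Qed.

Lemma grun_rcons (R : nzRingType) (al : R) i pos st w y :
  grun al i pos st (rcons w y) =
  obind (fun s => omap (merges i (pos + size w).+1) (gread al (pos + size w) s y))
    (grun al i pos st w).
Proof. by rewrite -cats1 grun_cat; case: grun => //= s; case: gread. Qed.

(** * Unrolling the recursion over blocks *)

Lemma eq_grun (R : nzRingType) (al : R) i i' pos st w :
  (forall j, 0 < j <= size w ->
     minn i (logn 2 (pos + j)) = minn i' (logn 2 (pos + j))) ->
  grun al i pos st w = grun al i' pos st w.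
Proof.
elim: w pos st => //= y w IH pos st E; case: gread => //= s.
rewrite /merges -addn1 E // -/(merges i' _ s) IH // => j /andP[j0 jw].
by rewrite -addnA add1n E.
Qed.

Lemma dvdn_exp2_logn i m : 0 < m -> (2 ^ i %| m) = (i <= logn 2 m).
Proof. by move=> m0; rewrite pfactor_dvdn. Qed.

Lemma logn_in_block i pos j : 2 ^ i %| pos -> 0 < j < 2 ^ i ->
  logn 2 (pos + j) < i.
Proof.
move=> Hp /andP[j0 ji]; rewrite ltnNge -dvdn_exp2_logn ?addn_gt0 ?j0 ?orbT //.
by rewrite dvdn_addr // gtnNdvd.
Qed.

Lemma dvdn_exp2S i pos : 2 ^ i.+1 %| pos -> 2 ^ i %| pos.
Proof. by apply: dvdn_trans; rewrite dvdn_exp2l. Qed.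

Lemma merges_block (R : nzRingType) i pos (st : gstack R) : 2 ^ i.+1 %| pos.+1 ->
  merges i.+1 pos.+1 st = gmerge i.+1 (pos.+1 - 2 ^ i.+1) (merges i pos.+1 st).
Proof.
rewrite dvdn_exp2_logn // => Hi; rewrite /merges !(minn_idPl _) // 1?ltnW //.
have ->: iota 1 i.+1 = iota 1 i ++ [:: i.+1] by rewrite -[in LHS](addn1 i) iotaD add1n.
by rewrite foldl_cat.
Qed.

(** The midpoint of an aligned block has valuation exactly [i], so even a complete first half
    triggers no merge of level [i.+1]. *)
Lemma grun_first_half (R : nzRingType) (al : R) i pos st w :
  2 ^ i.+1 %| pos -> size w <= 2 ^ i ->
  grun al i.+1 pos st w = grun al i pos st w.
Proof.
move=> Hp Hw; apply: eq_grun => j /andP[j0 jw].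
have H : logn 2 (pos + j) < i.+1.
  apply: logn_in_block => //; rewrite j0 (leq_ltn_trans (leq_trans jw Hw)) //.
  by rewrite ltn_exp2l.
by rewrite !(minn_idPr _) // 1?ltnW // .
Qed.

(** The size bound is strict here, because the last letter of this half ends the whole block. *)
Lemma grun_second_half (R : nzRingType) (al : R) i pos st w :
  2 ^ i.+1 %| pos -> size w < 2 ^ i ->
  grun al i.+1 (pos + 2 ^ i) st w = grun al i (pos + 2 ^ i) st w.
Proof.
move=> Hp Hw; apply: eq_grun => j /andP[j0 jw].
have H : logn 2 (pos + 2 ^ i + j) < i.
  apply: logn_in_block; first by rewrite dvdn_addr // dvdn_exp2S.
  by rewrite j0 (leq_ltn_trans jw Hw).
by rewrite !(minn_idPr _) // 1?ltnW // 1?ltnW.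
Qed.

Lemma grun_block (R : nzRingType) (al : R) i pos st w1 w2 :
  2 ^ i.+1 %| pos -> size w1 = 2 ^ i -> size w2 = 2 ^ i ->
  grun al i.+1 pos st (w1 ++ w2) =
  obind (fun s => omap (gmerge i.+1 pos) (grun al i (pos + 2 ^ i) s w2))
    (grun al i pos st w1).
Proof.
move=> Hp H1 H2; rewrite grun_cat H1 grun_first_half ?H1 //.
case: (grun al i pos st w1) => //= s.
(* The last letter is split off: it is the only one after which the two levels differ, by the outer
   merge. *)
case/lastP: w2 H2 => [|w y]; rewrite ?size_rcons => Hw.
  by have := expn_gt0 2 i; rewrite -Hw.
rewrite !grun_rcons -grun_second_half //; last by rewrite -Hw.
case: grun => //= s1; case: gread => //= s2; congr Some.
have E : (pos + 2 ^ i + size w).+1 = pos + 2 ^ i.+1.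
  by rewrite expnS mul2n -addnn -[in RHS]Hw; lia.
by rewrite merges_block E ?addnK // dvdn_addr.
Qed.

(** * Invariants of stacks *)

(** Positive heights make the truncated [l.-1] a true subtraction. First indices at most [pos] keep
    old items out of the merges of a block that starts at [pos]. *)
Definition wf (R : Type) (pos : nat) (st : gstack R) : bool :=
  all (fun it => (0 < it.1.2) && (it.2 <= pos)) st.

Lemma wf_leq (R : Type) pos pos' (st : gstack R) : pos <= pos' -> wf pos st -> wf pos' st.
Proof.
move=> H; apply: sub_all => it /andP[-> H2] /=; exact: leq_trans H2 H.
Qed.

Lemma wf_gdown (R : nzRingType) (al : R) pos st y st' :
  gdown al st y = Some st' -> wf pos st -> wf pos st'.
Proof.
case: st => [|[[h l] f] st] //=; case: ifP => [_|Hl].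
  by case: ifP => // _ [<-] /andP[].
move=> [<-] /= /andP[/andP[l0 ->] ->]; lia.
Qed.

Lemma hgt_gdown (R : nzRingType) (al : R) pos st y st' :
  gdown al st y = Some st' -> wf pos st -> (hgt st').+1 = hgt st.
Proof.
case: st => [|[[h l] f] st] //=; case: ifP => [Hl|Hl].
  by case: ifP => // _ [<-] /andP[/andP[/= l0 _] _]; rewrite /hgt /=; lia.
move=> [<-] /= /andP[/andP[/= l0 _] _]; rewrite /hgt /=; lia.
Qed.

Lemma hgt_gmerge (R : nzRingType) i s (st : gstack R) : hgt (gmerge i s st) = hgt st.
Proof.
case: st => [|[[h2 l2] f2] [|[[h1 l1] f1] st]] //=; case: ifP => // _.
by rewrite /hgt /=; lia.
Qed.

Lemma wf_gmerge (R : nzRingType) i s pos (st : gstack R) : wf pos st -> wf pos (gmerge i s st).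
Proof.
case: st => [|[[h2 l2] f2] [|[[h1 l1] f1] st]] //=; case: ifP => // _ /= .
by case/and3P=> /andP[/= H1 H2] /andP[/= H3 H4] ->; rewrite H4 addn_gt0 H3.
Qed.

Lemma hgt_merges (R : nzRingType) i pos (st : gstack R) : hgt (merges i pos st) = hgt st.
Proof.
by rewrite /merges; elim: (iota _ _) st => //= j s IH st; rewrite IH hgt_gmerge.
Qed.

Lemma wf_merges (R : nzRingType) i p pos (st : gstack R) : wf pos st -> wf pos (merges i p st).
Proof.
rewrite /merges; elim: (iota _ _) st => //= j s IH st H; exact/IH/wf_gmerge.
Qed.

Lemma wf_gread (R : nzRingType) (al : R) pos st y st' :
  gread al pos st y = Some st' -> wf pos st -> wf pos.+1 st'.
Proof.
rewrite /gread; case: ifP => _; last by move=> /wf_gdown H /H /wf_leq; apply.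
by move=> [<-] /(wf_leq (leqnSn pos)) H; rewrite /= leqnn.
Qed.

Lemma hgt_gread (R : nzRingType) (al : R) pos st y st' :
  gread al pos st y = Some st' -> wf pos st ->
  hgt st' + ~~ upstep y = hgt st + upstep y.
Proof.
rewrite /gread; case: ifP => _; last by move=> /hgt_gdown H /H /=; lia.
by move=> [<-] _; rewrite /hgt /=; lia.
Qed.

Lemma wf_grun (R : nzRingType) (al : R) i pos st w st' :
  grun al i pos st w = Some st' -> wf pos st -> wf (pos + size w) st'.
Proof.
elim: w pos st => [|y w IH] pos st /=; first by move=> [<-]; rewrite addn0.
case E: gread => [s|] //= H Hst; rewrite addnS -addSn; apply: (IH _ _ H).
exact/wf_merges/(wf_gread E).
Qed.

Lemma hgt_grun (R : nzRingType) (al : R) i pos st w st' :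
  grun al i pos st w = Some st' -> wf pos st ->
  hgt st' + count (predC upstep) w = hgt st + count upstep w.
Proof.
elim: w pos st => [|y w IH] pos st /=; first by move=> [<-].
case E: gread => [s|] //= H Hst; have := hgt_gread E Hst.
have := IH _ _ H (wf_merges _ _ (wf_gread E Hst)); rewrite hgt_merges; lia.
Qed.

(** * Matching downsteps with stack items *)

Fixpoint drun (R : nzRingType) (al : R) (D : word) (st : gstack R) :=
  if D is d :: D' then obind (drun al D') (gdown al st d) else Some st.

(** With the last upstep first, [size U'] counts the upsteps of [U] that precede [u], and [H] is the
    height below all of them. *)
Fixpoint hashU (R : nzRingType) (al : R) (H : nat) (U : word) : R :=
  if U is u :: U' then (hash_at al (H + size U') u + hashU al H U')%R else 0%R.

Definition pushU (R : nzRingType) (al : R) (U : word) (f : nat) (st : gstack R) :=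
  if U is [::] then st else (hashU al (hgt st) U, size U, f) :: st.

Lemma drun_cat (R : nzRingType) (al : R) D D' st :
  drun al (D ++ D') st = obind (drun al D') (drun al D st).
Proof. by elim: D st => //= d D IH st; case: gdown. Qed.

Lemma wf_drun (R : nzRingType) (al : R) pos D st st' :
  drun al D st = Some st' -> wf pos st -> wf pos st'.
Proof.
elim: D st => [|d D IH] st /=; first by move=> [<-].
by case E: gdown => [s|] //= /IH + /(wf_gdown E); apply.
Qed.

Lemma hash_at_cancel (R : nzRingType) (al : R) H u : upstep u ->
  (hash_at al H u + hash_at al H.+1 (flip u) = 0)%R.
Proof. by case: u => //= _; rewrite ?addr0 ?subrr. Qed.

(** Letters of matching type cancel in the hash pair by pair, in any ring; an item emptied in this
    way has hash 0 and passes its check. *)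
Lemma drun_cancel (R : nzRingType) (al : R) U D u d f st :
  cancel_steps U D = Some (u, d) -> all upstep U ->
  drun al D (pushU al U f st) = drun al d (pushU al u f st).
Proof.
elim: U D => [|u0 U IH] [|d0 D] /=; [by move=> [<- <-] | by move=> [<- <-] | by move=> [<- <-] |].
case: eqP => // <- /IH {}IH /andP[Hu HU].
rewrite addrAC /hgt /= -/(hgt st) addSn addnC hash_at_cancel // add0r.
case: U IH HU => [|u1 U] IH HU /=; first by rewrite eqxx -IH.
by rewrite -IH.
Qed.

(* What is left of the hash of an item with unmatched letters [U] once these have
   been matched with [D]. *)
Fixpoint defect (R : nzRingType) (al : R) (H : nat) (U D : word) : R :=
  match U, D with
  | u :: U', d :: D' =>
    (((u == La)%:R - (d == La')%:R) * al ^+ (H + size U')  .+1 + defect al H U' D')%R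
  | _, _ => 0%R
  end.

Lemma hash_at_pair (R : nzRingType) (al : R) H u d : upstep u -> ~~ upstep d ->
  (hash_at al H u + hash_at al H.+1 d = ((u == La)%:R - (d == La')%:R) * al ^+ H.+1)%R.
Proof.
have La_ne : (Lb == La) = false by []; have Lb_ne : (Lb' == La') = false by [].
by case: u => // _; case: d => // _ /=; rewrite ?eqxx ?La_ne ?Lb_ne
  ?subrr ?mul0r ?subr0 ?mul1r ?sub0r ?mulN1r ?addr0 ?add0r.
Qed.

(** Since [U] is no longer than [D], the item is emptied and checked within [D]. The induction needs
    [e], which collects what the pairs already matched have left in the hash. *)
Lemma drun_defect (R : nzRingType) (al : R) (e : R) U D f st st' :
  all upstep U -> all (predC upstep) D -> 0 < size U <= size D ->
  drun al D ((e + hashU al (hgt st) U, size U, f) :: st)%R = Some st' ->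
  (e + defect al (hgt st) U D = 0)%R.
Proof.
elim: U e D => [|u U IH] e [|d D] //= /andP[Hu HU] /andP[Hd HD] HUD.
have E : (e + (hash_at al (hgt st + size U) u + hashU al (hgt st) U)
  + hash_at al (hgt ((e + (hash_at al (hgt st + size U) u + hashU al (hgt st) U), (size U).+1, f) :: st)) d
  = e + ((u == La)%:R - (d == La')%:R) * al ^+ (hgt st + size U).+1 + hashU al (hgt st) U)%R.
  rewrite -hash_at_pair // /hgt /= addSn -/(hgt st) [size U + _]addnC.
  by rewrite -!addrA; congr (_ + (_ + _))%R; rewrite addrC.
rewrite E; case: U IH HU HUD E => [|u1 U] IH HU HUD E.
  by rewrite eqxx addr0 /=; case: eqP => //; case: D {IH HD HUD E}; rewrite ?addr0.
by move=> /(IH _ _ HU HD HUD) <-; rewrite addrA.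
Qed.

Lemma glue_some a b DU : glue a b = Some DU -> exists D1 U1 D2 U2 u d,
  [/\ a = Some (D1, U1), b = Some (D2, U2), cancel_steps U1 D2 = Some (u, d)
    & DU = (D1 ++ d, U2 ++ u)].
Proof.
case: a b => [[D1 U1]|] [[D2 U2]|] //=; case E: cancel_steps => [[u d]|] //= [<-].
by exists D1, U1, D2, U2, u, d.
Qed.

Lemma hashU_cat (R : nzRingType) (al : R) H U V :
  hashU al H (U ++ V) = (hashU al (H + size V) U + hashU al H V)%R.
Proof.
by elim: U => [|u U IH] /=; rewrite ?add0r // IH size_cat addrA -addnA (addnC (size V)).
Qed.

Lemma gmerge_old (R : nzRingType) i pos (it : R * nat * nat) st :
  wf pos st -> gmerge i pos (it :: st) = it :: st.
Proof.
case: it => [[h2 l2] f2]; case: st => [|[[h1 l1] f1] st] //= /andP[/andP[_ /=]].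
by rewrite leqNgt => /negPf->.
Qed.

Lemma gmerge_wf (R : nzRingType) i pos (st : gstack R) : wf pos st -> gmerge i pos st = st.
Proof. by case: st => // it st /andP[_ H]; rewrite gmerge_old. Qed.

Lemma gmerge_pushU (R : nzRingType) (al : R) i pos U f st :
  wf pos st -> gmerge i pos (pushU al U f st) = pushU al U f st.
Proof. by case: U => [|u U] H; [exact: gmerge_wf | exact: gmerge_old]. Qed.

Lemma pushU_cons (R : nzRingType) (al : R) U f st :
  U != [::] -> pushU al U f st = (hashU al (hgt st) U, size U, f) :: st.
Proof. by case: U. Qed.

Lemma gmerge_pushU2 (R : nzRingType) (al : R) i pos U2 f2 u f1 st :
  u != [::] -> U2 != [::] ->
  pos < f1 <= pos + 2 ^ i -> pos < f2 <= pos + 2 ^ i ->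
  gmerge i pos (pushU al U2 f2 (pushU al u f1 st)) = pushU al (U2 ++ u) f1 st.
Proof.
move=> Hu HU H1 H2; rewrite !pushU_cons //; last by case: (U2) HU.
rewrite {1}/gmerge H1 H2 hashU_cat size_cat.
rewrite (addrC (hashU al (hgt st) u)) (addnC (size u)).
by rewrite (_ : hgt (_ :: st) = hgt st + size u) // /hgt /= addnC.
Qed.

Lemma wf_pushU (R : nzRingType) (al : R) pos pos' U f st :
  wf pos st -> pos <= pos' -> f <= pos' -> wf pos' (pushU al U f st).
Proof.
move=> /wf_leq H /H Hw; case: U => //= u U ->; exact: Hw.
Qed.

(** Matched pairs inside the block leave no trace in the stack. The range of [f] is kept because the
    merge of the enclosing block tests it; failure of [drun] is covered by the equation too. *)
Lemma grun_reduce (R : nzRingType) (al : R) i pos st w D U :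
  size w = 2 ^ i -> 2 ^ i %| pos -> wf pos st -> reduce w = Some (D, U) ->
  exists2 f, pos < f <= pos + 2 ^ i &
    grun al i pos st w = omap (pushU al U f) (drun al D st).
Proof.
elim: i pos st w D U => [|i IH] pos st w D U.
  case: w => [|y [|//]] //= _ _ Hst; rewrite /reduce /= => E.
  exists pos.+1; first by rewrite addn1 leqnn.
  rewrite /merges min0n /= /gread; case: ifP E => Hy [<- <-] /=.
    by rewrite addr0 addn0.
  by case: gdown.
move=> Hw Hp Hst; rewrite -(cat_take_drop (2 ^ i) w) reduce_cat.
set w1 := take _ _; set w2 := drop _ _.
have H1 : size w1 = 2 ^ i by rewrite size_takel // Hw leq_exp2l.
have H2 : size w2 = 2 ^ i by rewrite size_drop Hw expnS mul2n -addnn addnK.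
move=> /glue_some [D1 [U1 [D2 [U2 [u [d [E1 E2 Ec [-> ->]]]]]]]].
have Hp1 := dvdn_exp2S Hp.
have Hp2 : 2 ^ i %| pos + 2 ^ i by rewrite dvdn_addr.
have [f1 Hf1 R1] := IH _ _ _ _ _ H1 Hp1 Hst E1.
rewrite grun_block // R1 drun_cat.
have lt2 : pos + 2 ^ i < pos + 2 ^ i.+1 by rewrite ltn_add2l ltn_exp2l.
have e2 : pos + 2 ^ i + 2 ^ i = pos + 2 ^ i.+1 by rewrite expnS mul2n -addnn addnA.
have Hf1' : pos < f1 <= pos + 2 ^ i.+1 by case/andP: Hf1 => -> /leq_trans; apply; apply: ltnW.
case Ed: (drun al D1 st) => [st'|] /=; last by exists f1.
have Hst' := wf_drun Ed Hst.
have /andP[_ HU1] := reduce_letters E1.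
have Hw2 : wf (pos + 2 ^ i) (pushU al U1 f1 st').
  by apply: wf_pushU Hst' _ _; [exact: leq_addr | case/andP: Hf1].
have [f2 + R2] := IH _ _ _ _ _ H2 Hp2 Hw2 E2; rewrite e2 => Hf2.
have Hf2' : pos < f2 <= pos + 2 ^ i.+1.
  by case/andP: Hf2 => H ->; rewrite (leq_ltn_trans (leq_addr _ _) H).
rewrite R2 (drun_cancel _ _ _ Ec HU1).
(* Either the item of the first half is used up, and nothing new lies under that of the second half,
   or part of it survives and the merge joins the two. *)
case: (cancel_steps_one_empty Ec) => Enil; subst.
  rewrite cats0; exists f2 => //=.
  case E: drun => [st''|] //=; rewrite gmerge_pushU //; exact: wf_drun E Hst'.
case: (eqVneq u [::]) => [->|Hu].
  by exists f2 => //=; rewrite cats0 gmerge_pushU.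
case: (eqVneq U2 [::]) => [->|HU2]; exists f1 => //=.
  by rewrite gmerge_pushU.
by rewrite gmerge_pushU2.
Qed.

(* The coefficient of the topmost level of a [defect] comes from one pair only,
   so pairs at different levels cannot compensate each other. *)
Lemma defect_eq0 (F : fieldType) H U D : all upstep U -> all (predC upstep) D ->
  size U <= size D -> defect 'X H U D = 0%R :> {poly F} ->
  cancel_steps U D != None.
Proof.
have size_defect V E : size (defect 'X H V E : {poly F}) <= (H + size V).+1.
  elim: V E => [|v V IH] [|e E] /=; rewrite ?size_poly0 //.
  apply: (leq_trans (size_polyD _ _)); rewrite geq_max; apply/andP; split; last first.
    by apply: (leq_trans (IH _)); rewrite addnS.
  rewrite -polyC_natr -(polyC_natr _ (e == La')) -polyCB mul_polyC.
  by apply: (leq_trans (size_scale_leq _ _)); rewrite size_polyXn addnS.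
elim: U D => //= u U IH [|d D] //= /andP[Hu HU] /andP[Hd HD] HUD E.
have : ((defect 'X H (u :: U) (d :: D) : {poly F})`_(H + size U).+1 = 0)%R.
  by rewrite /= E coef0.
rewrite /= -polyC_natr -(polyC_natr _ (d == La')) -polyCB mul_polyC coefD coefZ coefXn eqxx.
(* The remaining pairs have exponents at most [H + size U], one below that of the head pair. *)
rewrite (nth_default 0%R (size_defect U D)) addr0 mulr1 => /eqP; rewrite subr_eq0 => /eqP Ec.
have Eud : (u == La) = (d == La').
  by move: Ec; do 2 case: eqP => //= _; move=> /eqP; rewrite ?(oner_eq0, eq_sym 0%R).
have -> : flip u == d by case: (u) Hu Eud => //; case: (d) Hd.
by apply: IH => //; move: E; rewrite Eud subrr mul0r add0r.
Qed.

Lemma drun_matched (F : fieldType) U D f st : all upstep U -> all (predC upstep) D ->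
  size U <= size D -> drun ('X : {poly F}) D (pushU 'X U f st) != None ->
  cancel_steps U D != None.
Proof.
move=> HU HD Hs; case E: drun => [st'|] // _; apply: (@defect_eq0 F (hgt st)) => //.
case: (posnP (size U)) => [/size0nil->|U0]; first by case: (D).
rewrite -[LHS]add0r; apply: (drun_defect (e := 0%R) (f := f) HU HD (st' := st')).
  by rewrite U0.
by rewrite add0r -pushU_cons // -size_eq0 -lt0n.
Qed.

Lemma cancel_steps_flip U D :
  cancel_steps (map flip D) (map flip U) =
  omap (fun r : word * word => (map flip r.2, map flip r.1)) (cancel_steps U D).
Proof.
elim: U D => [|u U IH] [|d D] //=; rewrite flipK eq_sym.
by case: ifP.
Qed.

Lemma wf_grun_reduce (R : nzRingType) (al : R) i pos st w st' :
  wf pos st -> size w = 2 ^ i -> grun al i pos st w = Some st' -> wf (pos + 2 ^ i) st'.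
Proof. by move=> Hst <- /wf_grun; apply. Qed.

(* A mismatched pair that straddles the middle of a block is seen by the pass in
   which the half with fewer unmatched letters comes first: the stack item of
   that half is discarded within the block, hence checked before it is merged. *)
Lemma two_passes_reduce (F : fieldType) i w pos st pos' st' :
  size w = 2 ^ i -> 2 ^ i %| pos -> 2 ^ i %| pos' -> wf pos st -> wf pos' st' ->
  grun ('X : {poly F}) i pos st w != None ->
  grun ('X : {poly F}) i pos' st' (mirror w) != None -> reduce w != None.
Proof.
elim: i w pos st pos' st' => [|i IH] w pos st pos' st' Hw.
  by case: w Hw => [|y [|//]] //= _ _ _ _ _ _ _; rewrite /reduce /=; case: ifP.
move=> Hp Hp' Hst Hst'; rewrite -(cat_take_drop (2 ^ i) w) mirror_cat reduce_cat.
set w1 := take _ _; set w2 := drop _ _.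
have H1 : size w1 = 2 ^ i by rewrite size_takel // Hw leq_exp2l.
have H2 : size w2 = 2 ^ i by rewrite size_drop Hw expnS mul2n -addnn addnK.
have M1 : size (mirror w1) = 2 ^ i by rewrite size_mirror.
have M2 : size (mirror w2) = 2 ^ i by rewrite size_mirror.
rewrite !grun_block //.
case R1: grun => [s1|] //=; case R2: grun => [s2|] //= _.
case R2': grun => [s2'|] //=; case R1': grun => [s1'|] //= _.
have W1 := wf_grun_reduce Hst H1 R1; have W2' := wf_grun_reduce Hst' M2 R2'.
have Hq := dvdn_exp2S Hp; have Hq' := dvdn_exp2S Hp'.
have Hr : 2 ^ i %| pos + 2 ^ i by rewrite dvdn_addr.
have Hr' : 2 ^ i %| pos' + 2 ^ i by rewrite dvdn_addr.
(* In the reverse pass [w1] comes after [w2], so each half is met at a different position and over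
   an unrelated stack in the two passes. *)
have := IH w1 pos st (pos' + 2 ^ i) s2' H1 Hq Hr' Hst W2'.
have := IH w2 (pos + 2 ^ i) s1 pos' st' H2 Hr Hq' W1 Hst'.
rewrite R1 R2 R1' R2' => /(_ isT isT) + /(_ isT isT).
case E2: (reduce w2) => [[D2 U2]|] //; case E1: (reduce w1) => [[D1 U1]|] // _ _.
suff: cancel_steps U1 D2 != None by rewrite /=; case: cancel_steps.
have /andP[HD1 HU1] := reduce_letters E1; have /andP[HD2 HU2] := reduce_letters E2.
case: (leqP (size U1) (size D2)) => [le|/ltnW le].
  have [f _ Q1] := grun_reduce 'X%R H1 Hq Hst E1.
  move: Q1; rewrite R1; case: drun => [s|] //= [Es]; subst s1.
  have [f2 _] := grun_reduce 'X%R H2 Hr W1 E2; rewrite R2.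
  by case E: drun => [s0|] //= _; apply: (drun_matched (F := F) (f := f) (st := s)); rewrite ?E.
have E2m : reduce (mirror w2) = Some (map flip U2, map flip D2) by rewrite reduce_mirror E2.
have E1m : reduce (mirror w1) = Some (map flip U1, map flip D1) by rewrite reduce_mirror E1.
have [f _ Q2] := grun_reduce 'X%R M2 Hq' Hst' E2m.
move: Q2; rewrite R2'; case: drun => [s|] //= [Es]; subst s2'.
have [f1 _] := grun_reduce 'X%R M1 Hr' W2' E1m; rewrite R1'.
case E: drun => [s0|] //= _.
have /andP[A B] := reduce_letters E2m; have /andP[A' B'] := reduce_letters E1m.
suff: cancel_steps (map flip D2) (map flip U1) != None.
  by rewrite cancel_steps_flip; case: cancel_steps.
by apply: (drun_matched (F := F) (f := f) (st := s)); rewrite ?E ?size_map.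
Qed.

(** * Generic and random residues *)

Definition eval_stack (F : fieldType) (a : F) (st : gstack {poly F}) : gstack F :=
  [seq (it.1.1.[a]%R, it.1.2, it.2) | it <- st].

Lemma hgt_eval (F : fieldType) (a : F) st : hgt (eval_stack a st) = hgt st.
Proof. by rewrite /hgt -map_comp. Qed.

Lemma hash_at_eval (F : fieldType) (a : F) H y :
  ((hash_at 'X H y).[a] = hash_at a H y)%R.
Proof. by case: y; rewrite /= ?hornerN ?hornerXn ?horner0. Qed.

Lemma size_hash_at (F : fieldType) N H y : H + upstep y <= N ->
  size (hash_at 'X H y : {poly F}) <= N.+1.
Proof.
by case: y => /= H1; rewrite ?size_polyN ?size_polyXn ?size_poly0 ?ltnS //; move: H1;
  rewrite ?addn0 ?addn1.
Qed.

Definition degree_le (F : fieldType) (N : nat) (st : gstack {poly F}) : bool :=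
  all (fun it : {poly F} * nat * nat => size it.1.1 <= N.+1) st.

(** A bound on the number of accepting residues in algebraic form. The polynomial 1 covers
    rejections that do not depend on the residue, such as an empty stack. *)
Definition witness_against (F : fieldType) (N : nat) (ok : F -> bool) : Prop :=
  exists q : {poly F}, [/\ q != 0%R, size q <= N.+1 & forall a, ok a -> root q a].

Lemma witness_never (F : fieldType) (N : nat) (ok : F -> bool) :
  (forall a, ~~ ok a) -> witness_against N ok.
Proof.
move=> H; exists 1%R; split; rewrite ?oner_eq0 ?size_poly1 // => a.
by rewrite (negPf (H a)).
Qed.

Lemma witness_sub (F : fieldType) (N : nat) (ok ok' : F -> bool) :
  (forall a, ok' a -> ok a) -> witness_against N ok -> witness_against N ok'.
Proof. by move=> H [q [q0 qN Hq]]; exists q; split=> // a /H /Hq. Qed.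

(** A check of the zero polynomial passes at every residue, and a check of a nonzero polynomial is
    its own witness. *)
Lemma gread_eval (F : fieldType) N pos (st : gstack {poly F}) y :
  hgt st + upstep y <= N -> degree_le N st ->
  if gread 'X%R pos st y is Some s then
    degree_le N s /\ forall a, gread a pos (eval_stack a st) y = Some (eval_stack a s)
  else witness_against N (fun a => gread a pos (eval_stack a st) y != None).
Proof.
move=> HN Hd; rewrite /gread; case: ifP => Hy.
  by split=> [|a]; rewrite /= ?size_hash_at ?Hd // hgt_eval hash_at_eval.
case: st HN Hd => [|[[h l] f] st] HN /=; first by move=> _; exact: witness_never.
set st1 := (_ :: st); move/andP=> [Hh Hd].
have Hs : size (h + hash_at 'X (hgt st1) y)%R <= N.+1.
  rewrite (leq_trans (size_polyD _ _)) // geq_max Hh size_hash_at //.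
have He a : ((h + hash_at 'X (hgt st1) y).[a] = h.[a] + hash_at a (hgt (eval_stack a st1)) y)%R.
  by rewrite hornerD hash_at_eval hgt_eval.
case: ifP => Hl; last first.
  by split=> [|a]; rewrite /= ?Hs // -(He a).
case: eqP => [E|/eqP E].
  by split=> // a; rewrite -(He a) E horner0 eqxx.
exists (h + hash_at 'X (hgt st1) y)%R; split=> // a.
by rewrite -(He a) /root; case: ifP.
Qed.

Lemma gmerge_eval (F : fieldType) (a : F) i s st :
  gmerge i s (eval_stack a st) = eval_stack a (gmerge i s st).
Proof.
case: st => [|[[h2 l2] f2] [|[[h1 l1] f1] st]] //=; case: ifP => //= _.
by rewrite hornerD.
Qed.

Lemma merges_eval (F : fieldType) (a : F) i p st :
  merges i p (eval_stack a st) = eval_stack a (merges i p st).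
Proof.
by rewrite /merges; elim: (iota _ _) st => //= j l IH st; rewrite gmerge_eval IH.
Qed.

Lemma degree_le_merges (F : fieldType) N i p (st : gstack {poly F}) :
  degree_le N st -> degree_le N (merges i p st).
Proof.
rewrite /merges; elim: (iota _ _) st => //= j l IH st H; apply: IH.
case: st H => [|[[h2 l2] f2] [|[[h1 l1] f1] st]] //=; case: ifP => // _ /= .
by case/and3P=> H1 H2 ->; rewrite (leq_trans (size_polyD _ _)) // geq_max H1 H2.
Qed.

(* A run that fails over the polynomials fails a check of a nonzero polynomial,
   which the residue has to be a root of for its own run to go on. *)
Lemma grun_eval (F : fieldType) N i pos (st : gstack {poly F}) w :
  wf pos st -> hgt st + count upstep w <= N -> degree_le N st ->
  if grun 'X%R i pos st w is Some s then
    forall a, grun a i pos (eval_stack a st) w = Some (eval_stack a s)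
  else witness_against N (fun a => grun a i pos (eval_stack a st) w != None).
Proof.
elim: w pos st => [|y w IH] pos st //= Hw HN Hd.
have := gread_eval pos (N := N) (st := st) (y := y).
case E: gread => [s|] /=; last first.
  move=> H; apply: witness_sub (H _ Hd); last by move: HN; lia.
  by move=> a; case: gread.
case=> //; first by move: HN; lia.
move=> Hs Ha; have Hh := hgt_gread E Hw.
have := IH pos.+1 (merges i pos.+1 s) (wf_merges _ _ (wf_gread E Hw)).
rewrite hgt_merges => /(_ _ (degree_le_merges _ _ Hs)) {}IH.
have : hgt s + count upstep w <= N.
  by apply: leq_trans HN; rewrite addnA leq_add2r -Hh leq_addr.
move=> /IH; case: grun => [s'|] H.
  by move=> a; rewrite Ha /= merges_eval H.
by apply: witness_sub H => a; rewrite Ha /= merges_eval.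
Qed.

(** * From the recursive procedure to the unrolled run *)

Definition to_stack (p : nat) (st : gstack 'F_p) : stack p :=
  [seq (it.1.1, it.1.2%:Z%R, it.2) | it <- st].

(** Expresses [height w = hgt st] without leaving the natural numbers. *)
Definition balanced (R : Type) (st : gstack R) (w : word) : bool :=
  hgt st + count (predC upstep) w == count upstep w.

Lemma heightE w : height w = ((count upstep w)%:Z - (count (predC upstep) w)%:Z)%R.
Proof.
rewrite /height; elim: w => //= y w IH.
by case: y; rewrite /=; lia.
Qed.

(** [hash] computes the height from the input and [hash_at] from the stack; [balanced] makes them
    agree and turns the integer exponents into natural ones. *)
Lemma read_letter_gread p alpha x pos (st : gstack 'F_p) y :
  wf pos st -> onth x pos = Some y -> balanced st (take pos x) ->
  read_letter alpha x pos (to_stack st) =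
  if gread alpha%:R%R pos st y is Some s then Done pos.+1 (to_stack s) else Rejected.
Proof.
move=> Hw Hy /eqP Hb.
have Hp : pos < size x by rewrite -onthTE Hy.
have Hh : height (take pos x) = (hgt st)%:Z%R by rewrite heightE -Hb; lia.
have Ht : take pos.+1 x = rcons (take pos x) y.
  by rewrite (take_nth y Hp); congr rcons; exact: onth_nth Hy.
have Hh1 : upstep y -> height (take pos.+1 x) = (hgt st).+1%:Z%R.
  rewrite Ht heightE -cats1 !count_cat /= => Hu; rewrite Hu /=; move: Hb; lia.
have -> : read_letter alpha x pos (to_stack st) =
    let hy := hash_at alpha%:R%R (hgt st) y in
    if upstep y then Done pos.+1 ((hy, 1%R, pos.+1) :: to_stack st)
    else if to_stack st is (h, l, f) :: st' then
      let l' := (l - 1)%R in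
      let h' := (h + hy)%R in
      if l' == 0%R then
        if h' == 0%R then Done pos.+1 st' else Rejected
      else Done pos.+1 ((h', l', f) :: st')
    else Rejected.
  rewrite /read_letter Hy /hash /= Hy; case: (y) Hh1 => //= Hh1.
    by rewrite Hh1 // -exprnP.
  by rewrite Hh -exprnP.
rewrite /gread; case: ifP => // _; case: st {Hb Hh Hh1} Hw => [|[[h l] f] st] //=.
case/andP=> /andP[/= l0 _] _; have -> : (l%:Z - 1 = l.-1%:Z)%R by lia.
rewrite eqz_nat; case: ifP => _ //; by case: ifP.
Qed.

Lemma merge_top_gmerge p i start (st : gstack 'F_p) :
  merge_top i start (to_stack st) = to_stack (gmerge i start st).
Proof. by case: st => [|[[h2 l2] f2] [|[[h1 l1] f1] st]] //=; case: ifP. Qed.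

Lemma balanced_grun p (al : 'F_p) i pos st w s x :
  grun al i pos st w = Some s -> wf pos st -> balanced st x -> balanced s (x ++ w).
Proof.
move=> /hgt_grun H /H; rewrite /balanced !count_cat => E /eqP Hb; apply/eqP; lia.
Qed.

(** [Block] at level 0 reads nothing, whereas the body at level 1 reads a letter. Replacing level 0
    by the letter lets the induction start there. *)
Definition Block_or_letter p alpha x i start st : status p :=
  if i is 0 then read_letter alpha x start st else Block alpha x i start st.

Lemma Block_grun p alpha x i start (st : gstack 'F_p) :
  2 ^ i %| start -> start <= size x -> wf start st -> balanced st (take start x) ->
  Block_or_letter alpha x i start (to_stack st) =
  if grun alpha%:R%R i start st (take (2 ^ i) (drop start x)) is Some s then
    if start + 2 ^ i <= size x then Done (start + 2 ^ i) (to_stack s)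
    else Waiting (to_stack s)
  else Rejected.
Proof.
elim: i start st => [|i IH] start st Hd Hs Hw Hb.
  rewrite /Block_or_letter addn1.
  case: (ltnP start (size x)) => Hlt; last first.
    by rewrite drop_oversize //= /read_letter onth_default.
  have La0 := La; rewrite (drop_nth La) //= take0.
  rewrite (read_letter_gread _ Hw (y := nth La x start) _ Hb) //; last first.
    by rewrite onthE (nth_map La).
  by case: gread => //= s; rewrite /merges min0n.
have -> : Block_or_letter alpha x i.+1 start (to_stack st) =
    andThen (Block_or_letter alpha x i start (to_stack st)) (fun pos1 st1 =>
    andThen (Block_or_letter alpha x i pos1 st1) (fun pos2 st2 =>
    Done pos2 (merge_top i.+1 start st2))).
  by case: (i).
have Hd' := dvdn_exp2S Hd.
rewrite IH //.
have e2 : start + 2 ^ i + 2 ^ i = start + 2 ^ i.+1 by rewrite expnS mul2n -addnn addnA.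
(* If the stream ends inside the first half, the first call waits; if it ends exactly at the
   midpoint, the second call waits on its first letter. *)
case: (leqP (start + 2 ^ i) (size x)) => Hle; last first.
  have Hz : size (drop start x) < 2 ^ i by rewrite size_drop; lia.
  rewrite !take_oversize //; [|lia|lia].
  rewrite grun_first_half //; last exact: ltnW.
  case: grun => //= s; case: leqP => //; lia.
set w1 := take (2 ^ i) (drop start x).
have H1 : size w1 = 2 ^ i by rewrite size_takel // size_drop; lia.
have -> : take (2 ^ i.+1) (drop start x) = w1 ++ take (2 ^ i) (drop (start + 2 ^ i) x).
  by rewrite expnS mul2n -addnn takeD drop_drop addnC.
set w2 := take _ (drop (_ + _) x).
case E: (grun _ i start st w1) => [s|] /=; last first.
  by rewrite grun_cat grun_first_half ?H1 // E.
have Hws := wf_grun E Hw; rewrite H1 in Hws.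
have Hbs := balanced_grun E Hw Hb.
rewrite IH ?dvdn_addr //; last by rewrite takeD.
rewrite -/w2 e2.
case: leqP => Hle2; last first.
  have Hz : size w2 < 2 ^ i by rewrite size_take size_drop; case: ifP; lia.
  rewrite grun_cat grun_first_half ?H1 // E /= grun_second_half //.
  by case: grun.
have H2 : size w2 = 2 ^ i by rewrite size_takel // size_drop; lia.
rewrite grun_block // E /=; case: grun => //= s2; by rewrite merge_top_gmerge.
Qed.

(** * Padding and correctness of the two passes *)

Lemma levels_gt0 n : 1 < n -> 0 < levels n.
Proof. by move=> n1; rewrite /levels up_log_gt0. Qed.

Lemma levels_bounds n : 1 < n -> 2 ^ (levels n).-1 < n <= 2 ^ levels n.
Proof. by move=> n1; apply: up_log_bounds. Qed.

Lemma exp2_levels n : 1 < n -> 2 ^ levels n = (2 ^ (levels n).-1).*2.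
Proof. by move=> n1; rewrite -{1}(prednK (levels_gt0 n1)) expnS mul2n. Qed.

Lemma npadE n : 1 < n -> ~~ odd n -> (npad n)./2.*2 = npad n.
Proof.
move=> n1 n2; apply: even_halfK; rewrite /npad oddB; last by case/andP: (levels_bounds n1).
by rewrite exp2_levels // odd_double.
Qed.

Lemma size_pads m : size (flatten (nseq m [:: La; La'])) = m.*2.
Proof. by elim: m => //= m ->. Qed.

Lemma size_padded x : 1 < size x -> ~~ odd (size x) -> size (padded x) = 2 ^ levels (size x).
Proof.
move=> n1 n2; rewrite size_cat size_pads npadE // subnKC //.
by case/andP: (levels_bounds n1).
Qed.

Lemma mirroredE x : mirrored x = mirror (padded x).
Proof. by []. Qed.

Lemma Block_prefix p alpha X k j : 0 < k -> size X = 2 ^ k -> j <= 2 ^ k ->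
  Block alpha (take j X) k 0 [::] =
  if grun (alpha%:R : 'F_p)%R k 0 [::] (take j X) is Some s then
    if 2 ^ k <= j then Done (2 ^ k) (to_stack s) else Waiting (to_stack s)
  else Rejected :> status p.
Proof.
case: k => // k _ HX Hj.
have := @Block_grun p alpha (take j X) k.+1 0 [::] (dvdn0 _) (leq0n _) isT.
rewrite take0 drop0 => /(_ (eqxx _)) /= ->.
rewrite [take (2 ^ _) _]take_oversize size_takel ?HX //.
Qed.

Lemma pass1_okE p alpha x : 1 < size x -> ~~ odd (size x) ->
  pass1_ok p alpha x =
  (grun (alpha%:R : 'F_p)%R (levels (size x)) 0 [::] (padded x) == Some [::]).
Proof.
move=> n1 n2; have Hs := size_padded n1 n2.
rewrite /pass1_ok /pass1 Block_prefix ?levels_gt0 // leqnn take_oversize ?Hs //.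
by case: grun => [[|it s]|].
Qed.

Lemma pass2_okE p alpha x : 1 < size x -> ~~ odd (size x) ->
  pass2_ok p alpha x =
  (grun (alpha%:R : 'F_p)%R (levels (size x)) 0 [::] (mirror (padded x)) != None).
Proof.
move=> n1 n2; have Hs := size_padded n1 n2.
rewrite /pass2_ok /pass2 mirroredE Block_prefix ?size_mirror ?levels_gt0 //.
by rewrite leqnn take_oversize ?size_mirror ?Hs //; case: grun.
Qed.

(** [grun_reduce] is valid for every residue, so acceptance does not depend on [alpha]. *)
Lemma algorithm3_complete p alpha x : 1 < size x -> dyck2 x -> algorithm3 p alpha x.
Proof.
move=> n1 Hx; have n2 := dyck2_even Hx.
have Hr : reduce (padded x) = Some ([::], [::]) by rewrite reduce_pads; apply/dyck2_reduce.
have Hm : reduce (mirror (padded x)) = Some ([::], [::]) by rewrite reduce_mirror Hr.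
have Hs := size_padded n1 n2.
rewrite /algorithm3 n2 pass1_okE // pass2_okE //.
have [f _ ->] := grun_reduce (alpha%:R : 'F_p)%R Hs (dvdn0 _) (isT : wf 0 [::]) Hr.
by have [f' _ ->] := grun_reduce (alpha%:R : 'F_p)%R (etrans (size_mirror _) Hs) (dvdn0 _) (isT : wf 0 [::]) Hm.
Qed.

Lemma count_mirror w : count upstep (mirror w) = count (predC upstep) w.
Proof. by rewrite count_map count_rev; apply: eq_count => y; rewrite /= upstep_flip. Qed.

Lemma algorithm3_sound p x : 1 < size x -> ~ dyck2 x ->
  exists q : {poly 'F_p}, [/\ q != 0%R, size q <= (size x).+1 &
    forall alpha, algorithm3 p alpha x -> root q (alpha%:R)%R].
Proof.
move=> n1 Hx; set n := size x; set k := levels n; set X := padded x.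
have [n2|n2] := boolP (odd n).
  exists 1%R; split; rewrite ?oner_eq0 ?size_poly1 // => alpha.
  by rewrite /algorithm3 n2.
have Hs := size_padded n1 n2.
pose ok (a : 'F_p) := (grun a k 0 [::] X == Some [::]) && (grun a k 0 [::] (mirror X) != None).
suff [q [q0 qn Hq]] : witness_against n ok.
  exists q; split=> // alpha; rewrite /algorithm3 n2 pass1_okE // pass2_okE //; exact: Hq.
(* An unbalanced word never ends the first pass with an empty stack. For a balanced one, the upsteps
   are half of the padded word, [2 ^ k.-1 < n] of them, which bounds the degrees by [n]. *)
have [Hc|Hc] := eqVneq (count (predC upstep) X) (count upstep X); last first.
  apply: witness_never => a; apply: contra Hc => /andP[/eqP/hgt_grun/(_ isT) + _].
  by rewrite /hgt /= !add0n => ->.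
have HN : count upstep X <= n.
  have := count_predC upstep X; rewrite Hc Hs addnn exp2_levels // => /double_inj ->.
  by case/andP: (levels_bounds n1) => /ltnW.
have := @grun_eval 'F_p n k 0 [::] X isT; rewrite /hgt /= add0n => /(_ HN isT).
case E1: grun => [s|] /=; last first.
  by apply: witness_sub => a /andP[/eqP ->].
case: s E1 => [|it s] E1 H1; last first.
  by apply: witness_never => a; rewrite /ok H1.
have := @grun_eval 'F_p n k 0 [::] (mirror X) isT; rewrite /hgt /= add0n count_mirror Hc => /(_ HN isT).
case E2: grun => [s|] /=; last first.
  by apply: witness_sub => a /andP[_].
(* Both polynomial runs succeed, so all types match. The empty stack at the start leaves no
   unmatched downstep, and the empty stack at the end no unmatched upstep. *)
move=> _; case: Hx; apply/dyck2_reduce.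
have := @two_passes_reduce 'F_p k X 0 [::] 0 [::] Hs (dvdn0 _) (dvdn0 _) isT isT.
rewrite E1 E2 => /(_ isT isT).
case Er: reduce => [[D U]|] // _.
have [f _] := grun_reduce ('X : {poly 'F_p})%R Hs (dvdn0 _) (isT : wf 0 [::]) Er.
rewrite -/k E1; case: D Er => [|d D] //= Er.
case: U Er => [|u U] //= Er _.
by move: Er; rewrite /X /padded reduce_pads.
Qed.

Lemma card_algorithm3 p x : prime p -> 1 < size x -> ~ dyck2 x ->
  #|[set alpha : 'I_p | algorithm3 p alpha x]| <= size x.
Proof.
move=> pp n1 Hx; have [q [q0 qn Hq]] := algorithm3_sound p n1 Hx.
set A := [set _ | _]%SET.
rewrite -ltnS (leq_trans _ qn) // cardE -(size_map (fun a : 'I_p => (a%:R : 'F_p)%R)).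
apply: max_poly_roots => //.
  apply/allP => _ /mapP[a + ->]; rewrite mem_enum inE; exact: Hq.
rewrite map_inj_uniq ?enum_uniq // => a b /(congr1 val).
by rewrite /= !val_Fp_nat // !modn_small // => /val_inj.
Qed.

(** * Size of the stack *)

Lemma firsts_gmerge (R : nzRingType) i s (st : gstack R) :
  [seq it.2 | it <- gmerge i s st] =
  if [seq it.2 | it <- st] is f2 :: f1 :: r then
    if (s < f1 <= s + 2 ^ i) && (s < f2 <= s + 2 ^ i) then f1 :: r
    else f2 :: f1 :: r
  else [seq it.2 | it <- st].
Proof. by case: st => [|[[h2 l2] f2] [|[[h1 l1] f1] st]] //=; case: ifP. Qed.

Lemma firsts_gdown (R : nzRingType) (al : R) st y st' : gdown al st y = Some st' ->
  exists m, [seq it.2 | it <- st'] = drop m [seq it.2 | it <- st].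
Proof.
case: st => [|[[h l] f] st] //=; case: ifP => _; last by move=> [<-]; exists 0.
by case: ifP => // _ [<-]; exists 1; rewrite /= drop0.
Qed.

(* A completed block leaves at most one item of its own on top of what remains
   of the initial stack, so an unfinished one has at most one per level. *)
Lemma size_grun_block (R : nzRingType) (al : R) i pos st w st' :
  2 ^ i %| pos -> size w <= 2 ^ i -> wf pos st -> grun al i pos st w = Some st' ->
  size st' <= size st + i.+1 /\
  (size w = 2 ^ i -> exists a m,
     [/\ [seq it.2 | it <- st'] = a ++ drop m [seq it.2 | it <- st],
         size a <= 1 & all (fun f => pos < f <= pos + 2 ^ i) a]).
Proof.
elim: i pos st w st' => [|i IH] pos st w st'.
  case: w => [|y [|//]] _ _ Hw /=; first by move=> [<-]; rewrite leq_addr.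
  rewrite /gread /merges min0n; case: ifP => _ /= .
    move=> [<-]; split=> [|_] /=; first by rewrite addn1.
    by exists [:: pos.+1], 0; rewrite drop0; split=> //=; rewrite expn0 addn1 ltnSn.
  case E: gdown => [s|] //= [<-]; have [m Hm] := firsts_gdown E; split=> [|_].
    by rewrite -(size_map snd s) Hm size_drop size_map; lia.
  by exists [::], m.
move=> Hp Hw Hst; have Hp' := dvdn_exp2S Hp.
case: (leqP (size w) (2 ^ i)) => Hlt.
  rewrite grun_first_half // => /(IH _ _ _ _ Hp' Hlt Hst) [H1 _]; split; first lia.
  by move=> E; move: Hlt; rewrite E leq_exp2l // ltnn.
rewrite -(cat_take_drop (2 ^ i) w); set w1 := take _ _; set w2 := drop _ _.
have H1 : size w1 = 2 ^ i by rewrite size_takel // ltnW.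
have H2 : size w2 <= 2 ^ i by rewrite size_drop; move: Hw; rewrite expnS; lia.
have Hr : 2 ^ i %| pos + 2 ^ i by rewrite dvdn_addr.
rewrite grun_cat grun_first_half ?H1 //; case E1: grun => [s1|] //=.
have Hs1 := wf_grun E1 Hst; rewrite H1 in Hs1.
have [_ /(_ H1) [b [m' [Eb b1 Hb]]]] := IH _ _ _ _ Hp' (eq_leq H1) Hst E1.
(* A completed first half costs one item, which pays for the second half being one level lower. *)
have Hsize : size s1 <= (size st).+1.
  by rewrite -(size_map snd) Eb size_cat size_drop size_map; lia.
case: (ltnP (size w2) (2 ^ i)) => Hlt2.
  rewrite grun_second_half // => /(IH _ _ _ _ Hr H2 Hs1) [H3 _].
  split; first lia; rewrite size_cat H1 expnS; lia.
have {Hlt2} H2e : size w2 = 2 ^ i by apply/eqP; rewrite eqn_leq H2.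
have -> : grun al i.+1 (pos + 2 ^ i) s1 w2 = omap (gmerge i.+1 pos) (grun al i (pos + 2 ^ i) s1 w2).
  have := grun_block al st Hp H1 H2e; rewrite grun_cat H1 grun_first_half ?H1 // E1 /=.
  by [].
case E2: grun => [s2|] //= [<-].
have [_ /(_ H2e) [a [m [Ea a1 Ha]]]] := IH _ _ _ _ Hr H2 Hs1 E2.
have Hst2 : all (fun f => f <= pos) [seq it.2 | it <- st].
  by rewrite all_map; apply: sub_all Hst => it /andP[].
suff H : exists a m, [/\ [seq it.2 | it <- gmerge i.+1 pos s2] = a ++ drop m [seq it.2 | it <- st],
         size a <= 1 & all (fun f => pos < f <= pos + 2 ^ i.+1) a].
  split=> [|_ //]; case: H => c [m2 [Ec c1 _]].
  by rewrite -(size_map snd) Ec size_cat size_drop size_map; lia.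
have e2 : pos + 2 ^ i + 2 ^ i = pos + 2 ^ i.+1 by rewrite expnS mul2n -addnn addnA.
have Ha' : all (fun f => pos < f <= pos + 2 ^ i.+1) a.
  by apply: sub_all Ha => f; rewrite e2; lia.
have Hb' : all (fun f => pos < f <= pos + 2 ^ i.+1) b.
  by apply: sub_all Hb => f; rewrite -e2; lia.
rewrite firsts_gmerge Ea Eb.
have Hold n : all (fun f => f <= pos) (drop n [seq it.2 | it <- st]).
  by apply/allP => f /mem_drop; apply: (allP Hst2).
have keep f2 r : all (fun f => f <= pos) r ->
  (if f2 :: r is f2 :: f1 :: r then
    if (pos < f1 <= pos + 2 ^ i.+1) && (pos < f2 <= pos + 2 ^ i.+1) then f1 :: r
    else f2 :: f1 :: r
  else f2 :: r) = f2 :: r.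
  by case: r => //= f1 r /andP[H _]; rewrite ltnNge H.
have keep0 r : all (fun f => f <= pos) r ->
  (if r is f2 :: f1 :: r then
    if (pos < f1 <= pos + 2 ^ i.+1) && (pos < f2 <= pos + 2 ^ i.+1) then f1 :: r
    else f2 :: f1 :: r
  else r) = r.
  by case: r => // f r /andP[_ H]; apply: keep.
(* [b] is what the first half leaves and [a] what the second half adds; [m = 0] means that the item
   of [b] survives the second half. Only then, with both present, does the merge act. *)
case: b b1 Eb Hb Hb' => [|g [|//]] _ Eb Hb Hb'.
  case: a a1 Ea Ha Ha' => [|f [|//]] _ Ea Ha Ha'; rewrite /= drop_drop.
    by exists [::], (m + m'); rewrite keep0.
  by exists [:: f], (m + m'); rewrite keep.
case: m Ea => [|m] Ea.
  case: a a1 Ea Ha Ha' => [|f [|//]] _ Ea Ha Ha'; rewrite /=.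
    by exists [:: g], m'; rewrite keep.
  exists [:: g], m'; split=> //=.
  by move: Ha' Hb' => /= /andP[-> _] /andP[-> _].
case: a a1 Ea Ha Ha' => [|f [|//]] _ Ea Ha Ha'; rewrite /= drop_drop.
  by exists [::], (m + m'); rewrite keep0.
by exists [:: f], (m + m'); rewrite keep.
Qed.

Lemma size_grun (R : nzRingType) (al : R) k w st :
  size w <= 2 ^ k -> grun al k 0 [::] w = Some st -> size st <= k.+1.
Proof.
by move=> Hw E; have [] := size_grun_block (st := [::]) (dvdn0 _) Hw isT E.
Qed.

(** * Executions *)

Fixpoint loop_free (c : cmd) : bool :=
  match c with
  | Seq c d | If _ c d => loop_free c && loop_free d
  | While _ _ => false
  | _ => true
  end.

(** The value on [While] is a default; the function is meant for loop-free commands. *)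
Fixpoint den (c : cmd) (m : memory) : memory :=
  match c with
  | Skip | While _ _ => m
  | Op r o v w => put m r (eval_op o (value m v) (value m w))
  | Push v => push m (value m v)
  | Pop r => pop m r
  | Seq c d => den d (den c m)
  | If b c d => if eval_test m b then den c m else den d m
  end.

Definition bounded (L Q : nat) (m : memory) : bool :=
  all (fun v => v < 2 ^ L) (regs m ++ pushdown m)
  && (size (regs m) + size (pushdown m) <= Q).

Lemma bits_le v L : 0 < L -> v < 2 ^ L -> bits v <= L.
Proof.
move=> L0 vL; rewrite /bits; case: v vL => [|v] vL; first by rewrite trunc_log0.
by rewrite -(ltn_exp2l _ _ (ltnSn 1)) (leq_ltn_trans _ vL) // trunc_logP.
Qed.

Lemma ltn_bits v : v < 2 ^ bits v.
Proof. exact: trunc_log_ltn. Qed.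

Lemma bounded_mono L Q L' Q' m : L <= L' -> Q <= Q' -> bounded L Q m -> bounded L' Q' m.
Proof.
move=> HL HQ /andP[H1 H2]; rewrite /bounded (leq_trans H2 HQ) andbT.
apply: sub_all H1 => v Hv; apply: (leq_trans Hv); by rewrite leq_exp2l.
Qed.

Lemma memory_size_bounded L Q m : 0 < L -> bounded L Q m -> memory_size m <= L * Q.
Proof.
move=> L0 /andP[H1]; rewrite -size_cat /memory_size; move: (_ ++ _) H1 => s H1 H2.
apply: (@leq_trans (L * size s)); last by rewrite leq_mul2l H2 orbT.
elim: s H1 {H2} => [|v s IH] /=; first by rewrite big_nil.
by case/andP=> Hv /IH Hs; rewrite big_cons mulnS leq_add // bits_le.
Qed.

Lemma exec_within_mono t s t' s' c m m' : t <= t' -> s <= s' ->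
  exec_within t s c m m' -> exec_within t' s' c m m'.
Proof.
move=> Ht Hs [t0 [s0 [He H1 H2]]]; exists t0, s0; split=> //.
  exact: leq_trans H1 Ht.
exact: leq_trans H2 Hs.
Qed.

Lemma exec_within_seq t1 t2 s c d m m1 m2 :
  exec_within t1 s c m m1 -> exec_within t2 s d m1 m2 ->
  exec_within (t1 + t2) s (Seq c d) m m2.
Proof.
move=> [t [s1 [E1 Ht Hs]]] [t' [s2 [E2 Ht' Hs']]].
exists (t + t'), (maxn s1 s2); split; first exact: exec_seq E1 E2.
  exact: leq_add.
by rewrite geq_max Hs.
Qed.

Lemma exec_within_if t s b c d m m' :
  exec_within t s (if eval_test m b then c else d) m m' ->
  exec_within (test_cost m b + t) s (If b c d) m m'.
Proof.
move=> [t' [s' [E Ht Hs]]]; exists (test_cost m b + t'), s'; split=> //.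
  exact: exec_if.
by rewrite leq_add2l.
Qed.

(* Multiplications double the length of numbers, but the number of operations in
   a loop-free program does not depend on its input. *)
Definition cheap (K : nat) (c : cmd) : Prop := forall L Q m, 0 < L -> bounded L Q m ->
  exec_within (K * L ^ 2) (K * L * (Q + K)) c m (den c m) /\
  bounded (K * L) (Q + K) (den c m).

Definition const_bits (v : operand) : nat := if v is Cst v then bits v else 0.

Lemma value_bound L Q m v : 0 < L -> bounded L Q m ->
  value m v < 2 ^ ((const_bits v).+1 * L).
Proof.
move=> L0 /andP[H _]; case: v => [v|r] /=.
  apply: (leq_trans (ltn_bits v)); rewrite leq_exp2l //; nia.
rewrite mul1n /Defs.get; case: (ltnP r (size (regs m))) => Hr; last by rewrite nth_default ?expn_gt0.
by move: H; rewrite all_cat => /andP[/all_nthP H _]; apply: H.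
Qed.

Lemma value_bits L Q m v : 0 < L -> bounded L Q m -> bits (value m v) <= (const_bits v).+1 * L.
Proof. by move=> L0 H; apply: bits_le (value_bound _ L0 H); rewrite muln_gt0. Qed.

Lemma all_set_nth (P : pred nat) s r v : all P s -> P 0 -> P v -> all P (set_nth 0 s r v).
Proof.
move=> Hs H0 Hv; apply/(all_nthP 0) => i _; rewrite nth_set_nth /=.
case: eqP => // _; case: (ltnP i (size s)) => Hi; last by rewrite nth_default.
by move/all_nthP: Hs => ->.
Qed.

Lemma bounded_put L Q m r v : bounded L Q m -> v < 2 ^ L -> bounded L (Q + r.+1) (put m r v).
Proof.
rewrite /bounded !all_cat => /andP[/andP[H1 H2] H3] Hv /=.
rewrite all_set_nth ?expn_gt0 // H2 size_set_nth /maxn; case: ifP => _; lia.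
Qed.

Definition test_const (b : test) : nat :=
  match b with
  | TestEq v w | TestLt v w => const_bits v + const_bits w + 2
  | TestEmpty => 1
  end.

Lemma test_cost_bound L Q m b : 0 < L -> bounded L Q m ->
  test_cost m b <= test_const b * L ^ 2.
Proof.
move=> L0 H; apply: (@leq_trans (test_const b * L)); last first.
  by rewrite leq_mul2l -{1}(expn1 L) leq_pexp2l // orbT.
case: b => [v w|v w|] /=; last by rewrite mul1n.
all: have := value_bits v L0 H; have := value_bits w L0 H; lia.
Qed.

Lemma eval_op_bound o v w a b : 0 < a -> 0 < b -> v < 2 ^ a -> w < 2 ^ b ->
  eval_op o v w < 2 ^ (a + b).
Proof.
move=> a0 b0 Hv Hw; rewrite expnD.
have Ha : 2 <= 2 ^ a by rewrite -{1}(expn1 2) leq_exp2l.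
have Hb : 2 <= 2 ^ b by rewrite -{1}(expn1 2) leq_exp2l.
have Hv' : v < 2 ^ a * 2 ^ b by nia.
case: o => /=; [nia | lia | nia | |].
- exact: leq_ltn_trans (leq_div _ _) Hv'.
- exact: leq_ltn_trans (leq_mod _ _) Hv'.
Qed.

Lemma op_cost_bound o v w a b : bits v <= a -> bits w <= b ->
  op_cost o v w <= a + b + a * b.
Proof. by case: o => /=; nia. Qed.

Lemma cheap_mono K K' c : K <= K' -> cheap K c -> cheap K' c.
Proof.
move=> HK H L Q m L0 /(H _ _ _ L0) [H1 H2]; split.
  apply: exec_within_mono H1; first by rewrite leq_mul2r HK orbT.
  by rewrite !leq_mul // leq_add2l.
by apply: bounded_mono H2; rewrite ?leq_mul2r ?HK ?orbT // leq_add2l.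
Qed.

Lemma space_le K L Q : 0 < K -> L * Q <= K * L * (Q + K).
Proof. by move=> K0; rewrite leq_mul ?leq_addr // leq_pmull. Qed.

Lemma loop_free_cheap c : loop_free c -> exists K, 0 < K /\ cheap K c.
Proof.
elim: c => [|r o v w|v|r|c IHc d IHd|b c IHc d IHd|//] /=.
- move=> _; exists 1; split=> // L Q m L0 H; split.
    exists 1, (memory_size m); split; first exact: exec_skip.
      by rewrite mul1n expn_gt0 L0.
    by have := memory_size_bounded L0 H; nia.
  by apply: bounded_mono H; lia.
- move=> _; set a := (const_bits v).+1; set b := (const_bits w).+1.
  (* The operands have at most [a * L] and [b * L] bits, so the cost involves their sum and their
     product; [r.+1] allows for the extension of the register file. *)
  exists (a + b + a * b + r.+1); set K := _ + r.+1; split=> // L Q m L0 H.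
  have Hv := value_bound v L0 H; have Hw := value_bound w L0 H.
  have Hb : bounded (K * L) (Q + K) (den (Op r o v w) m).
    apply: (@bounded_mono (a * L + b * L) (Q + r.+1)); [rewrite /K; nia | rewrite /K; lia |].
    apply: bounded_put; first by apply: bounded_mono H; rewrite /a /b; nia.
    by apply: eval_op_bound; rewrite // muln_gt0.
  split=> //; exists (op_cost o (value m v) (value m w)), (maxn (memory_size m) (memory_size (den (Op r o v w) m))).
  split; first exact: exec_op.
    apply: leq_trans (op_cost_bound o (value_bits v L0 H) (value_bits w L0 H)) _.
    rewrite -/a -/b /K; clearbody a b; nia.
  have KL : 0 < K * L by rewrite muln_gt0 L0 /K addnS.
  rewrite geq_max (memory_size_bounded KL Hb) andbT.
  by apply: leq_trans (memory_size_bounded L0 H) (space_le _ _ _); rewrite ?addnS.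
- move=> _; set a := (const_bits v).+1; exists a.+1; split=> // L Q m L0 H.
  have Hv := value_bound v L0 H.
  have Hb : bounded (a.+1 * L) (Q + a.+1) (den (Push v) m).
    case/andP: (H) => H1 H2; rewrite /bounded /= addnS; apply/andP; split; last lia.
    rewrite all_cat /=.
    have : bounded (a.+1 * L) Q m by apply: bounded_mono H; nia.
    case/andP; rewrite all_cat => /andP[-> ->] _; rewrite !andbT.
    by apply: leq_trans Hv _; rewrite leq_exp2l // -/a; nia.
  split=> //; exists (bits (value m v)), (maxn (memory_size m) (memory_size (den (Push v) m))).
  split; first exact: exec_push.
    by apply: leq_trans (value_bits v L0 H) _; rewrite -/a; nia.
  have KL : 0 < a.+1 * L by rewrite muln_gt0 L0.
  rewrite geq_max (memory_size_bounded KL Hb) andbT.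
  by apply: leq_trans (memory_size_bounded L0 H) (space_le _ _ _); rewrite ?addnS.
- move=> _; exists r.+2; split=> // L Q m L0 H.
  have Hh : head 0 (pushdown m) < 2 ^ L.
    case/andP: H => + _; rewrite all_cat => /andP[_]; case: pushdown => [|v s] /=; first by rewrite expn_gt0.
    by case/andP.
  have Hb : bounded (r.+2 * L) (Q + r.+2) (den (Pop r) m).
    apply: (@bounded_mono L (Q + r.+1)); [nia | lia |].
    case/andP: (H); rewrite /bounded !all_cat => /andP[H1 H2] H3 /=.
    rewrite all_set_nth ?expn_gt0 //= size_set_nth size_behead.
    apply/andP; split; last by rewrite /maxn; case: ifP; lia.
    by apply/allP => v /mem_behead; apply: (allP H2).
  split=> //; exists (bits (head 0 (pushdown m))), (maxn (memory_size m) (memory_size (den (Pop r) m))).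
  split; first exact: exec_pop.
    by apply: leq_trans (bits_le L0 Hh) _; nia.
  have KL : 0 < r.+2 * L by rewrite muln_gt0 L0.
  rewrite geq_max (memory_size_bounded KL Hb) andbT.
  by apply: leq_trans (memory_size_bounded L0 H) (space_le _ _ _); rewrite ?addnS.
- move=> /andP[/IHc [K1 [K10 H1]] /IHd [K2 [K20 H2]]].
  (* The second command starts from numbers of [K1 * L] bits, whence [K2 * K1 ^ 2] for its time and
     [K2 * K1] for the final length. *)
  exists (K1 + K2 * K1 ^ 2 + K2 * K1 + K2); set K := _ + K2; split; first by rewrite /K; lia.
  move=> L Q m L0 H.
  have KL : 0 < K1 * L by rewrite muln_gt0 K10.
  have [E1 B1] := H1 _ _ _ L0 H; have [E2 B2] := H2 _ _ _ KL B1; split; last first.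
    by apply: bounded_mono B2; rewrite /K; nia.
  have HK2 : K2 * K1 <= K by rewrite /K; nia.
  apply: (@exec_within_mono (K1 * L ^ 2 + K2 * (K1 * L) ^ 2) (K * L * (Q + K))) => //.
    by rewrite expnMn /K; nia.
  apply: exec_within_seq.
    apply: exec_within_mono E1 => //; rewrite !leq_mul //; rewrite /K; lia.
  apply: exec_within_mono E2 => //; rewrite mulnA leq_mul // ?leq_mul //; rewrite /K; nia.
- move=> /andP[/IHc [K1 [K10 H1]] /IHd [K2 [K20 H2]]].
  exists (test_const b + K1 + K2); set K := _ + K2; split; first by rewrite /K; lia.
  move=> L Q m L0 H; split.
    apply: (@exec_within_mono (test_cost m b + (K1 + K2) * L ^ 2) (K * L * (Q + K))) => //.
      by have := test_cost_bound b L0 H; rewrite /K; nia.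
    rewrite [den _ _]/=; apply: exec_within_if; case: ifP => _.
      have [X _] := H1 _ _ _ L0 H; apply: exec_within_mono X; first nia.
      by rewrite !leq_mul //; rewrite /K; lia.
    have [X _] := H2 _ _ _ L0 H; apply: exec_within_mono X; first nia.
    by rewrite !leq_mul //; rewrite /K; lia.
  rewrite [den _ _]/=; case: ifP => _.
    by have [_ X] := H1 _ _ _ L0 H; apply: bounded_mono X; rewrite /K; nia.
  by have [_ X] := H2 _ _ _ L0 H; apply: bounded_mono X; rewrite /K; nia.
Qed.

(** [cheap] allows each execution of the body to lengthen numbers by a factor [K], so it cannot be
    iterated by itself. The invariant restores the bound [L] before every iteration, and its index
    bounds the iterations left. *)
Lemma while_within K b c L Q (I : nat -> memory -> Prop) :
  0 < L -> cheap K c ->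
  (forall r m, I r m -> bounded L Q m) ->
  (forall m, I 0 m -> ~~ eval_test m b) ->
  (forall r m, I r.+1 m -> eval_test m b -> I r (den c m)) ->
  forall r m, I r m -> exists m',
    [/\ exec_within (r.+1 * ((K + test_const b).+1 * L ^ 2)) (K.+1 * L * (Q + K)) (While b c) m m',
        exists r', I r' m' & ~~ eval_test m' b].
Proof.
move=> L0 Hc Hb H0 HS; set W := (_ + _).+1 * _.
have stop r m : I r m -> ~~ eval_test m b -> exists m',
    [/\ exec_within (r.+1 * W) (K.+1 * L * (Q + K)) (While b c) m m',
        exists r', I r' m' & ~~ eval_test m' b].
  move=> Hm Ht; exists m; split=> //; last by exists r.
  exists (test_cost m b), (memory_size m); split; first exact: exec_while_end.
    by have := test_cost_bound b L0 (Hb _ _ Hm); rewrite /W; nia.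
  by have := memory_size_bounded L0 (Hb _ _ Hm); nia.
elim=> [|r IH] m Hm; first exact: stop Hm (H0 _ Hm).
have [Ht|/(stop _ _ Hm) //] := boolP (eval_test m b).
have [m' [[t2 [s2 [E2 T2 S2]]] Hr' Ht']] := IH _ (HS _ _ Hm Ht).
exists m'; split=> //.
have [[t1 [s1 [E1 T1 S1]]] _] := Hc _ _ _ L0 (Hb _ _ Hm).
exists (test_cost m b + t1 + t2), (maxn s1 s2); split; first exact: exec_while_step E1 E2.
  have := test_cost_bound b L0 (Hb _ _ Hm); move: T1 T2; rewrite [r.+2 * W]mulSn /W; nia.
by rewrite geq_max S2 (leq_trans S1) // leq_mul // leq_mul2r leqnSn orbT.
Qed.

(** * Determinism of executions *)

Lemma exec_det c m m1 t1 s1 : exec c m m1 t1 s1 ->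
  forall m2 t2 s2, exec c m m2 t2 s2 -> m1 = m2.
Proof.
elim=> {c m m1 t1 s1}.
- by move=> m m2 t2 s2 E; inversion E.
- by move=> r o v w m m' m2 t2 s2 E; inversion E.
- by move=> v m m' m2 t2 s2 E; inversion E.
- by move=> r m m' m2 t2 s2 E; inversion E.
- move=> c d m m1 m2 t1 t2 s1 s2 _ IH1 _ IH2 m3 t3 s3 E; inversion E; subst.
  have ? : m1 = m4 by apply: IH1; eassumption.
  by subst; apply: IH2; eassumption.
- move=> b c d m m' t s _ IH m2 t2 s2 E; inversion E; subst.
  by apply: IH; eassumption.
- move=> b c m Hb m2 t2 s2 E; inversion E; subst => //.
  by match goal with H : is_true (eval_test _ _) |- _ => rewrite H in Hb end.
- move=> b c m m1 m2 t1 t2 s1 s2 Hb _ IH1 _ IH2 m3 t3 s3 E; inversion E; subst.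
    by match goal with H : is_true (~~ _) |- _ => rewrite Hb in H end.
  have ? : m1 = m4 by apply: IH1; eassumption.
  by subst; apply: IH2; eassumption.
Qed.

Lemma exec_within_det t s t' s' c m m1 m2 :
  exec_within t s c m m1 -> exec_within t' s' c m m2 -> m1 = m2.
Proof. by move=> [a [b [E _ _]]] [a' [b' [E' _ _]]]; exact: exec_det E _ _ _ E'. Qed.

Lemma feed_det t s t' s' c m w ms ms' :
  feed t s c m w ms -> feed t' s' c m w ms' -> ms = ms'.
Proof.
move=> F; elim: F ms' => {m w ms} [m|m y w m1 ms E _ IH] ms' F'; inversion F'; subst => //.
match goal with H : exec_within t' _ _ _ _ |- _ => have ? := exec_within_det E H end.
by subst; congr cons; apply: IH.
Qed.

Lemma run_passes_det t s t' s' x Ps m tr m1 tr' m2 :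
  run_passes t s x Ps m tr m1 -> run_passes t' s' x Ps m tr' m2 -> tr = tr' /\ m1 = m2.
Proof.
move=> F; elim: F tr' m2 => {Ps m tr m1} [m|P Ps m ms m1 tr m2 F1 E _ IH] tr' m3 F';
  inversion F'; subst => //.
match goal with H : feed t' _ _ _ _ _ |- _ => have ? := feed_det F1 H end; subst.
match goal with H : exec_within t' _ _ _ _ |- _ => have ? := exec_within_det E H end; subst.
by match goal with H : run_passes t' _ _ _ _ _ _ |- _ => have [-> ->] := IH _ _ H end.
Qed.

(** [implements_algorithm3] speaks of every run under arbitrary bounds; by this lemma it is enough
    to construct one run. *)
Lemma run_det M t s t' s' p alpha x tr m1 tr' m2 :
  run M t s p alpha x tr m1 -> run M t' s' p alpha x tr' m2 -> tr = tr' /\ m1 = m2.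
Proof.
move=> [m E R1] [m' E' R2]; have ? := exec_within_det E E'; subst.
exact: run_passes_det R1 R2.
Qed.

(** * The program *)

Lemma val_Fp_add p (x y : 'F_p) : prime p -> nat_of_ord (x + y)%R = (x + y) %% p.
Proof. by move=> pp; case: x y => [x Hx] [y Hy] /=; rewrite Fp_cast. Qed.

Lemma val_Fp_opp p (x : 'F_p) : prime p -> nat_of_ord (- x)%R = (p - x) %% p.
Proof. by move=> pp; case: x => [x Hx] /=; rewrite Fp_cast. Qed.

Lemma ltn_Fp p (x : 'F_p) : prime p -> x < p.
Proof. by move=> pp; case: x => [x Hx] /=; move: Hx; rewrite Fp_cast. Qed.

Lemma val_Fp_eq0 p (x : 'F_p) : (nat_of_ord x == 0) = (x == 0%R).
Proof. by []. Qed.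

Lemma val_Fp_exp p a e : prime p -> nat_of_ord (a%:R ^+ e : 'F_p)%R = a ^ e %% p.
Proof. by move=> pp; rewrite -natrX val_Fp_nat. Qed.

Definition seqs (l : seq cmd) : cmd := foldr Seq Skip l.

Definition assign (r : nat) (v : operand) : cmd := Op r Add v (Cst 0).

Definition is_letter (y : letter) : test := TestEq (Reg 3) (Cst (letter_code y)).

(* Registers: 5 the number of letters read, 6 the height, 7, 8, 9 the base,
   exponent and result of a modular exponentiation, later the start and the
   length of a block and the rest of the position modulo that length; 10 to 15
   two stack items. *)
Definition preprocessing : cmd :=
  seqs [:: assign 15 (Cst 0); Op 4 Mod (Reg 0) (Cst 2); Op 4 Defs.Sub (Cst 1) (Reg 4)].

(** For an upstep the height is raised before the exponentiation; for a downstep it is lowered only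
    afterwards, in [match_downstep]. This gives both exponents of [hash_at]. *)
Definition prepare_hash : cmd :=
  seqs [:: Op 5 Add (Reg 5) (Cst 1);
    If (is_letter La) (Op 6 Add (Reg 6) (Cst 1))
      (If (is_letter Lb) (Op 6 Add (Reg 6) (Cst 1)) Skip);
    assign 7 (Reg 2); assign 8 (Reg 6); assign 9 (Cst 1)].

Definition power_step : cmd :=
  seqs [:: Op 10 Mod (Reg 8) (Cst 2);
    If (TestEq (Reg 10) (Cst 1))
      (Seq (Op 9 Mul (Reg 9) (Reg 7)) (Op 9 Mod (Reg 9) (Reg 1))) Skip;
    Op 7 Mul (Reg 7) (Reg 7); Op 7 Mod (Reg 7) (Reg 1);
    Op 8 Div (Reg 8) (Cst 2); assign 10 (Cst 0)].

Definition push_upstep : cmd := seqs [:: Push (Reg 5); Push (Cst 1); Push (Reg 9)].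

Definition push_item (r : nat) : cmd :=
  seqs [:: Push (Reg r.+2); Push (Reg r.+1); Push (Reg r)].

Definition pop_item (r : nat) : cmd := seqs [:: Pop r; Pop r.+1; Pop r.+2].

Definition clear_item (r : nat) : cmd :=
  seqs [:: assign r (Cst 0); assign r.+1 (Cst 0); assign r.+2 (Cst 0)].

Definition match_downstep : cmd :=
  seqs [:: Op 6 Defs.Sub (Reg 6) (Cst 1);
    If TestEmpty (assign 4 (Cst 0))
      (seqs [:: pop_item 10;
        Op 11 Defs.Sub (Reg 11) (Cst 1);
        Op 10 Add (Reg 10) (Reg 9); Op 10 Mod (Reg 10) (Reg 1);
        If (TestEq (Reg 11) (Cst 0))
          (If (TestEq (Reg 10) (Cst 0)) Skip (assign 4 (Cst 0)))
          (push_item 10);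
        clear_item 10])].

Definition read_step : cmd :=
  seqs [:: If (is_letter La) push_upstep
      (If (is_letter Lb) (Seq (assign 9 (Cst 0)) push_upstep)
      (If (is_letter La') (Seq (Op 9 Defs.Sub (Reg 1) (Reg 9)) match_downstep)
      (Seq (assign 9 (Cst 0)) match_downstep)));
    assign 7 (Cst 0); assign 8 (Cst 2); Op 9 Mod (Reg 5) (Reg 8)].

(** Only the lower bounds of [in_block] are tested: the block ends at the current position, which no
    first index exceeds. *)
Definition merge_step : cmd :=
  seqs [:: Op 7 Defs.Sub (Reg 5) (Reg 8);
    If TestEmpty Skip
      (Seq (pop_item 10)
        (If TestEmpty (push_item 10)
          (Seq (pop_item 13)
            (If (TestLt (Reg 7) (Reg 15))
              (If (TestLt (Reg 7) (Reg 12))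
                (seqs [:: Op 13 Add (Reg 13) (Reg 10); Op 13 Mod (Reg 13) (Reg 1);
                  Op 14 Add (Reg 14) (Reg 11); push_item 13])
                (Seq (push_item 13) (push_item 10)))
              (Seq (push_item 13) (push_item 10))))));
    clear_item 10; clear_item 13; assign 7 (Cst 0);
    Op 8 Mul (Reg 8) (Cst 2); Op 9 Mod (Reg 5) (Reg 8)].

Definition finish_letter : cmd :=
  seqs [:: assign 3 (Cst 0); assign 8 (Cst 0); assign 9 (Cst 0)].

Definition alive : test := TestEq (Reg 4) (Cst 1).

Definition process_letter : cmd :=
  If alive
    (seqs [:: prepare_hash; While (TestLt (Cst 0) (Reg 8)) power_step; read_step;
      If alive (Seq (While (TestEq (Reg 9) (Cst 0)) merge_step) finish_letter) Skip])
    Skip.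

Definition flip_letter : cmd :=
  If (is_letter La) (assign 3 (Cst (letter_code La')))
  (If (is_letter La') (assign 3 (Cst (letter_code La)))
  (If (is_letter Lb) (assign 3 (Cst (letter_code Lb')))
  (assign 3 (Cst (letter_code Lb))))).

(* The padding leaves the stack as it is when it ends the first pass, and empty
   when it begins the second one, so it is skipped. *)
Definition end_first_pass : cmd :=
  If alive
    (If TestEmpty
      (seqs [:: assign 7 (Cst 1); While (TestLt (Reg 7) (Reg 0)) (Op 7 Mul (Reg 7) (Cst 2));
        Op 5 Defs.Sub (Reg 7) (Reg 0); assign 7 (Cst 0)])
      (assign 4 (Cst 0)))
    Skip.

Definition program : streaming_program :=
  StreamingProgram preprocessing
    [:: Pass LeftToRight process_letter end_first_pass;
        Pass RightToLeft (Seq flip_letter process_letter) Skip].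

(** * Effect of the commands on memories *)

Definition enc (p : nat) (st : gstack 'F_p) : seq nat :=
  flatten [seq [:: nat_of_ord it.1.1; it.1.2; it.2] | it <- st].

Lemma encode_to_stack p (st : gstack 'F_p) : encode_stack (to_stack st) = enc st.
Proof. by rewrite /encode_stack /to_stack -map_comp. Qed.

(** Each stage clears its scratch registers 10 to 15, so the memory between stages always has this
    shape. *)
Definition mem_of (p n al y ok pos H A B C : nat) (st : gstack 'F_p) : memory :=
  Memory [:: n; p; al; y; ok; pos; H; A; B; C; 0; 0; 0; 0; 0; 0] (enc st).

Lemma den_prepare p n al y pos H (st : gstack 'F_p) :
  den prepare_hash (mem_of n al (letter_code y) 1 pos H 0 0 0 st) =
  mem_of n al (letter_code y) 1 pos.+1 (H + upstep y) al (H + upstep y) 1 st.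
Proof. by rewrite /mem_of; case: y => /=; rewrite ?addn0 ?addn1. Qed.

Lemma den_power p n al y pos H A B C (st : gstack 'F_p) :
  den power_step (mem_of n al y 1 pos H A B C st) =
  mem_of n al y 1 pos H ((A * A) %% p) B./2 (if odd B then (C * A) %% p else C) st.
Proof.
rewrite /mem_of /= /Defs.get /= modn2 divn2.
by case: (odd B).
Qed.

Lemma val_Fp_down p (h : 'F_p) al e : prime p ->
  (h + (p - al ^ e %% p)) %% p = nat_of_ord (h - al%:R ^+ e)%R.
Proof. by move=> pp; rewrite val_Fp_add // val_Fp_opp // val_Fp_exp // modnDmr. Qed.

Lemma val_Fp_down0 p (h : 'F_p) : prime p -> (h + 0) %% p = nat_of_ord (h + 0)%R.
Proof. by move=> pp; rewrite addr0 addn0 modn_small // ltn_Fp. Qed.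

(** After a rejection the leftover stack matters only for the space bound, hence the mere inclusion
    of entries. *)
Lemma den_match_downstep p n al y pos A B (st : gstack 'F_p) yl d : prime p -> wf pos st ->
  (forall h : 'F_p, (h + d) %% p =
     nat_of_ord (h + hash_at (al%:R : 'F_p) (hgt st) yl)%R) ->
  let m := den match_downstep (mem_of n al y 1 pos (hgt st) A B d st) in
  if gdown (al%:R)%R st yl is Some s then m = mem_of n al y 1 pos (hgt s) A B d s
  else exists2 s : gstack 'F_p, {subset enc s <= enc st} /\ size s <= size st &
    m = mem_of n al y 0 pos (hgt st).-1 A B d s.
Proof.
move=> pp; case: st => [|[[h l] f] st] Hw Hd; first by exists [::]; split.
rewrite /gdown; move: (Hd h); move: (h + _)%R => h' Hv.
case/andP: Hw => /andP[/= l0 _] _; rewrite /mem_of /= /Defs.get /=.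
rewrite !addn0 !subn1 Hv -val_Fp_eq0; case: ifP => [/eqP El|El] /=; last first.
  rewrite /mem_of /hgt /enc /=; congr (Memory [:: _, _, _, _, _, _, _ & _] _).
  by lia.
case: ifP => [/eqP E0|E0] /=.
  by rewrite E0 El /= /mem_of /hgt /= (_ : l = 1) //; lia.
exists st; split=> //=; rewrite ?leqW //.
by move=> v; rewrite /enc /= !inE => ->; rewrite !orbT.
Qed.

Definition reset_read : cmd :=
  seqs [:: assign 7 (Cst 0); assign 8 (Cst 2); Op 9 Mod (Reg 5) (Reg 8)].

Lemma den_readE y m : Defs.get m 3 = letter_code y ->
  den read_step m = den reset_read
    match y with
    | La => den push_upstep m
    | Lb => den push_upstep (den (assign 9 (Cst 0)) m)
    | La' => den match_downstep (den (Op 9 Defs.Sub (Reg 1) (Reg 9)) m)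
    | Lb' => den match_downstep (den (assign 9 (Cst 0)) m)
    end.
Proof.
move=> E; have T z : eval_test m (is_letter z) = (letter_code y == letter_code z) by rewrite -E.
change (den read_step m) with (den reset_read
  (if eval_test m (is_letter La) then den push_upstep m
   else if eval_test m (is_letter Lb) then den push_upstep (den (assign 9 (Cst 0)) m)
   else if eval_test m (is_letter La') then
     den match_downstep (den (Op 9 Defs.Sub (Reg 1) (Reg 9)) m)
   else den match_downstep (den (assign 9 (Cst 0)) m))).
by rewrite !T; case: (y).
Qed.

Lemma den_reset p n al y ok pos H A B C (st : gstack 'F_p) :
  den reset_read (mem_of n al y ok pos H A B C st) = mem_of n al y ok pos H 0 2 (pos %% 2) st.
Proof. by []. Qed.

Lemma den_push_upstep p n al y ok pos H A B (v : 'F_p) st :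
  den push_upstep (mem_of n al y ok pos H A B v st) =
  mem_of n al y ok pos H A B v ((v, 1, pos) :: st).
Proof. by []. Qed.

Lemma den_assign9 p n al y ok pos H A B C (st : gstack 'F_p) :
  den (assign 9 (Cst 0)) (mem_of n al y ok pos H A B C st) = mem_of n al y ok pos H A B 0 st.
Proof. by []. Qed.

Lemma den_sub9 p n al y ok pos H A B C (st : gstack 'F_p) :
  den (Op 9 Defs.Sub (Reg 1) (Reg 9)) (mem_of n al y ok pos H A B C st) =
  mem_of n al y ok pos H A B (p - C) st.
Proof. by []. Qed.

Lemma den_read p n al y pos A (st : gstack 'F_p) : prime p -> wf pos st ->
  let H := hgt st + upstep y in
  let m := den read_step (mem_of n al (letter_code y) 1 pos.+1 H
    A 0 (al ^ H %% p) st) in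
  if gread (al%:R)%R pos st y is Some s then
    m = mem_of n al (letter_code y) 1 pos.+1 (hgt s) 0 2 (pos.+1 %% 2) s
  else exists2 s : gstack 'F_p, {subset enc s <= enc st} /\ size s <= size st &
    m = mem_of n al (letter_code y) 0 pos.+1 (hgt st).-1 0 2 (pos.+1 %% 2) s.
Proof.
move=> pp Hw; cbv zeta; rewrite (@den_readE y) //.
have Hw' := wf_leq (leqnSn pos) Hw.
have down d : ~~ upstep y ->
    (forall h : 'F_p, (h + d) %% p = nat_of_ord (h + hash_at (al%:R : 'F_p) (hgt st) y)%R) ->
    let m := den reset_read (den match_downstep
      (mem_of n al (letter_code y) 1 pos.+1 (hgt st) A 0 d st)) in
    if gread (al%:R)%R pos st y is Some s then
      m = mem_of n al (letter_code y) 1 pos.+1 (hgt s) 0 2 (pos.+1 %% 2) s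
    else exists2 s : gstack 'F_p, {subset enc s <= enc st} /\ size s <= size st &
      m = mem_of n al (letter_code y) 0 pos.+1 (hgt st).-1 0 2 (pos.+1 %% 2) s.
  move=> Hy Hd; cbv zeta; rewrite /gread (negPf Hy).
  have := @den_match_downstep p n al (letter_code y) pos.+1 A 0 st y d pp Hw' Hd.
  cbv zeta; case: gdown => [s ->|[s Hs ->]]; first by rewrite den_reset.
  by exists s; rewrite ?den_reset.
have up (v : 'F_p) : upstep y -> v = hash_at (al%:R)%R (hgt st) y ->
    let m := den reset_read (den push_upstep
      (mem_of n al (letter_code y) 1 pos.+1 (hgt st).+1 A 0 v st)) in
    if gread (al%:R)%R pos st y is Some s then
      m = mem_of n al (letter_code y) 1 pos.+1 (hgt s) 0 2 (pos.+1 %% 2) s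
    else exists2 s : gstack 'F_p, {subset enc s <= enc st} /\ size s <= size st &
      m = mem_of n al (letter_code y) 0 pos.+1 (hgt st).-1 0 2 (pos.+1 %% 2) s.
  by move=> Hy Hv; cbv zeta; rewrite /gread Hy -Hv den_push_upstep den_reset.
have [Hy|Hy] := boolP (upstep y); rewrite ?addn1 ?addn0; case: (y) Hy up down => // Hy up down.
- rewrite -val_Fp_exp //; exact: (up _ isT).
- rewrite den_sub9; apply: (down _ isT) => h; exact: val_Fp_down.
- rewrite den_assign9; apply: (down _ isT) => h; exact: val_Fp_down0.
Qed.

Lemma den_merge p n al y pos H i (st : gstack 'F_p) : prime p -> wf pos st ->
  2 ^ i <= pos ->
  den merge_step (mem_of n al y 1 pos H 0 (2 ^ i) 0 st) =
  mem_of n al y 1 pos H 0 (2 ^ i.+1) (pos %% 2 ^ i.+1) (gmerge i (pos - 2 ^ i) st).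
Proof.
move=> pp Hw Hi; rewrite expnSr.
case: st Hw => [|[[h2 l2] f2] [|[[h1 l1] f1] st]] Hw.
- by rewrite /mem_of /= /Defs.get /= !addn0.
- by rewrite /mem_of /= /Defs.get /= !addn0.
have {Hw} [Hf1 Hf2] : f1 <= pos /\ f2 <= pos by case/and3P: Hw => /andP[_ /= ->] /andP[_ /= ->].
have Hv := val_Fp_add h1 h2 pp; rewrite /gmerge; move: (h1 + h2)%R Hv => h Hv.
rewrite subnK // Hf1 Hf2 !andbT /mem_of /= /Defs.get /= !addn0.
case: ifP => H1 /=; last by rewrite /= /enc /= ?addn0.
case: ifP => H2 /=; last by rewrite /= /enc /= ?addn0.
by rewrite /enc /= ?addn0 -Hv.
Qed.

Lemma den_finish p n al y pos H B C (st : gstack 'F_p) :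
  den finish_letter (mem_of n al y 1 pos H 0 B C st) = mem_of n al 0 1 pos H 0 0 0 st.
Proof. by rewrite /mem_of /= !addn0. Qed.

Lemma den_flip p n al y ok pos H A B C (st : gstack 'F_p) :
  den flip_letter (mem_of n al (letter_code y) ok pos H A B C st) =
  mem_of n al (letter_code (flip y)) ok pos H A B C st.
Proof. by case: y. Qed.

(** * Time and space of a letter *)

Definition all_cheap (K : nat) : Prop :=
  foldr (fun c P => cheap K c /\ P) True
    [:: Skip; preprocessing; prepare_hash; power_step; read_step; merge_step;
        finish_letter; flip_letter; assign 7 (Cst 1); Op 7 Mul (Reg 7) (Cst 2);
        seqs [:: Op 5 Defs.Sub (Reg 7) (Reg 0); assign 7 (Cst 0)]; assign 4 (Cst 0)].

Lemma all_cheap_exists : exists K, 10 <= K /\ all_cheap K.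
Proof.
rewrite /all_cheap; set l := _ :: _.
have: List.Forall loop_free l by repeat constructor.
elim: l => [_|c l IH Hl]; first by exists 10.
inversion Hl as [|c' l' Hc Hl']; subst.
have [K1 [_ C1]] := loop_free_cheap Hc; have [K2 [K20 C2]] := IH Hl'.
exists (K1 + K2); split; first lia; split; first exact: cheap_mono (leq_addr _ _) C1.
elim: l C2 {IH Hl Hl'} => //= d l IH [Hd /IH HK2]; split=> //.
exact: cheap_mono (leq_addl _ _) Hd.
Qed.

(** [k + 3] bits leave room for positions and heights up to [2 ^ k], for the doubled block length up
    to [2 ^ k.+1], and for the small constants. *)
Definition word_bound (p n al k L : nat) : bool :=
  [&& n < 2 ^ L, p < 2 ^ L, al < p & k + 3 <= L].

(** Sixteen registers and three numbers per item. Between letters there are at most [k.+1] items; an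
    upstep adds one before the merges. *)
Definition Qsize (k : nat) : nat := 16 + 3 * (k + 2).

Lemma enc_bounded p pos L (st : gstack 'F_p) : prime p -> wf pos st -> p < 2 ^ L ->
  pos < 2 ^ L -> hgt st < 2 ^ L -> all (fun v => v < 2 ^ L) (enc st).
Proof.
move=> pp + Hp Hpos; elim: st => [|[[h l] f] st IH] //= /andP[/andP[_ /= Hf] Hw].
rewrite /hgt /= -/(hgt st) => Hh.
rewrite (ltn_trans (ltn_Fp h pp) Hp) (leq_ltn_trans (leq_addr _ _) Hh) (leq_ltn_trans Hf Hpos) /=.
apply: IH => //; exact: leq_ltn_trans (leq_addl _ _) Hh.
Qed.

Lemma size_enc p (st : gstack 'F_p) : size (enc st) = 3 * size st.
Proof. by elim: st => //= it st IH; rewrite /enc /= -/(enc st) IH mulnS. Qed.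

Lemma mem_of_bounded p n al y ok pos H A B C L k (st : gstack 'F_p) :
  [&& n < 2 ^ L, p < 2 ^ L, al < 2 ^ L, y < 2 ^ L, ok < 2 ^ L, pos < 2 ^ L, H < 2 ^ L,
    A < 2 ^ L, B < 2 ^ L & C < 2 ^ L] ->
  all (fun v => v < 2 ^ L) (enc st) -> size st <= k + 2 ->
  bounded L (Qsize k) (mem_of n al y ok pos H A B C st).
Proof.
case/and5P=> H1 H2 H3 H4 /and5P[H5 H6 H7 H8 /andP[H9 H10]] Hst Hs.
rewrite /bounded /= Hst H1 H2 H3 H4 H5 H6 H7 H8 H9 H10 !expn_gt0 /= size_enc /Qsize; lia.
Qed.

Lemma size_gmerge (R : nzRingType) i s (st : gstack R) : size (gmerge i s st) <= size st.
Proof. by case: st => [|[[h2 l2] f2] [|[[h1 l1] f1] st]] //=; case: ifP => //= _; rewrite leqW. Qed.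

Lemma size_merges (R : nzRingType) i p (st : gstack R) : size (merges i p st) <= size st.
Proof.
rewrite /merges; elim: (iota _ _) st => //= j l IH st; exact: leq_trans (IH _) (size_gmerge _ _ _).
Qed.

Lemma size_gread (R : nzRingType) (al : R) pos st y s :
  gread al pos st y = Some s -> size s <= (size st).+1.
Proof.
rewrite /gread; case: ifP => _; first by move=> [<-].
case: st => [|[[h l] f] st] //=; case: ifP => _; last by move=> [<-] /=; lia.
by case: ifP => // _ [<-]; lia.
Qed.

(** Pays for one loop-free command or for one loop iteration with its test, when [K] bounds the
    constants of both. *)
Definition step_time (K L : nat) : nat := (K.*2).+1 * L ^ 2.
Definition run_space (K L k : nat) : nat := K.+1 * L * (Qsize k + K).

Lemma cheap_exec K L k c m : 0 < L -> cheap K c -> bounded L (Qsize k) m ->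
  exec_within (step_time K L) (run_space K L k) c m (den c m).
Proof.
move=> L0 Hc Hm; have [X _] := Hc _ _ _ L0 Hm; apply: exec_within_mono X.
  by rewrite leq_mul2r -addnn; apply/orP; right; lia.
by rewrite /run_space leq_mul // leq_mul2r leqnSn orbT.
Qed.

Lemma while_exec K L k b c (I : nat -> memory -> Prop) : 0 < L -> cheap K c ->
  test_const b <= K ->
  (forall r m, I r m -> bounded L (Qsize k) m) ->
  (forall m, I 0 m -> ~~ eval_test m b) ->
  (forall r m, I r.+1 m -> eval_test m b -> I r (den c m)) ->
  forall r m, I r m -> exists m',
    [/\ exec_within (r.+1 * step_time K L) (run_space K L k) (While b c) m m',
        exists r', I r' m' & ~~ eval_test m' b].
Proof.
move=> L0 Hc Hb HI H0 HS r m Hm.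
have [m' [E Hr Ht]] := while_within L0 Hc HI H0 HS Hm.
exists m'; split=> //; apply: exec_within_mono E => //.
by rewrite leq_mul2l /step_time leq_mul2r -addnn; apply/orP; right; apply/orP; right; lia.
Qed.

Lemma if_exec K L k t b c d m m' : 0 < L -> test_const b <= K -> bounded L (Qsize k) m ->
  exec_within t (run_space K L k) (if eval_test m b then c else d) m m' ->
  exec_within (step_time K L + t) (run_space K L k) (If b c d) m m'.
Proof.
move=> L0 Hb Hm /exec_within_if; apply: exec_within_mono => //.
rewrite leq_add2r; apply: leq_trans (test_cost_bound b L0 Hm) _.
by rewrite /step_time leq_mul2r -addnn; apply/orP; right; lia.
Qed.

Lemma power_loop p n al y pos k L K H (st : gstack 'F_p) m :
  prime p -> word_bound p n al k L -> 10 <= K -> cheap K power_step ->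
  wf pos st -> hgt st < 2 ^ L -> pos < 2 ^ L -> y < 2 ^ L -> H < 2 ^ k.+1 -> size st <= k + 2 ->
  m = mem_of n al y 1 pos H al H 1 st ->
  exists2 A, A < p & exec_within (k.+2 * step_time K L) (run_space K L k)
    (While (TestLt (Cst 0) (Reg 8)) power_step) m
    (mem_of n al y 1 pos H A 0 (al ^ H %% p) st).
Proof.
move=> pp /and4P[Hn Hp Hal HkL] HK Hc Hw Hh Hpos Hy HH Hs ->.
have L0 : 0 < L by lia.
have one : 1 < 2 ^ L by rewrite -{1}(expn0 2) ltn_exp2l.
(* The invariant of square and multiply; the exponent [B] is halved each time, so [B < 2 ^ r] bounds
   the iterations left. *)
pose I r m := exists A B C, [/\ m = mem_of n al y 1 pos H A B C st,
  A < p /\ C < p, B < 2 ^ r, B < 2 ^ L & C * A ^ B = al ^ H %[mod p]].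
have HH' : H < 2 ^ L by apply: leq_trans HH _; rewrite leq_exp2l //; lia.
have [] := @while_exec K L k (TestLt (Cst 0) (Reg 8)) power_step I L0 Hc _ _ _ _ k.+1
  (mem_of n al y 1 pos H al H 1 st).
- by rewrite /= /bits trunc_log0; lia.
- move=> r m' [A [B [C [-> [HA HC] _ HB _]]]]; apply: mem_of_bounded => //; last first.
    exact: enc_bounded pp Hw Hp Hpos Hh.
  by rewrite Hn Hp (ltn_trans Hal Hp) Hy one Hpos HH' HB (ltn_trans HA Hp) (ltn_trans HC Hp).
- by move=> m' [A [B [C [-> _]]]]; case: B.
- move=> r m' [A [B [C [-> [HA HC] HB HB' E]]]] Ht.
  exists (A * A %% p), B./2, (if odd B then (C * A) %% p else C); split.
  + exact: den_power.
  + by rewrite ltn_pmod ?prime_gt0 //; case: odd; rewrite ?ltn_pmod ?prime_gt0.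
  + by move: HB; rewrite expnS mul2n; have := odd_double_half B; lia.
  + by apply: leq_ltn_trans HB'; have := odd_double_half B; lia.
  + rewrite -E -[in RHS](odd_double_half B) expnD -mul2n expnM -[A ^ 2]/(A * A).
    by case: odd; rewrite -modnMm modnXm ?modn_mod ?modnMm ?expn1 ?expn0 ?mul1n ?mulnA.
- exists al, H, 1; split=> //; first by split; [|exact: prime_gt1].
  by rewrite mul1n.
move=> m' [E [r [A [B [C [Em' [HA HC] _ _ Em]]]]]] Ht; exists A => //; subst m'.
have B0 : B = 0 by move: Ht; rewrite /= /Defs.get /= -leqNgt leqn0 => /eqP.
by move: E Em; rewrite B0 expn0 muln1 (modn_small HC) => E <-.
Qed.

Lemma merge_loop p n al y pos k L K (st : gstack 'F_p) :
  prime p -> word_bound p n al k L -> 10 <= K -> cheap K merge_step ->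
  wf pos st -> hgt st < 2 ^ L -> 0 < pos <= 2 ^ k -> y < 2 ^ L -> size st <= k + 2 ->
  exec_within (k.+2 * step_time K L) (run_space K L k)
    (While (TestEq (Reg 9) (Cst 0)) merge_step)
    (mem_of n al y 1 pos (hgt st) 0 2 (pos %% 2) st)
    (mem_of n al y 1 pos (hgt st) 0 (2 ^ (logn 2 pos).+1)
       (pos %% 2 ^ (logn 2 pos).+1) (merges k pos st)).
Proof.
move=> pp /and4P[Hn Hp Hal HkL] HK Hc Hw Hh /andP[pos0 Hpos] Hy Hs.
have L0 : 0 < L by lia.
have one : 1 < 2 ^ L by rewrite -{1}(expn0 2) ltn_exp2l.
have HkL2 : 2 ^ k.+2 < 2 ^ L by rewrite ltn_exp2l //; lia.
have HposL : pos < 2 ^ L.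
  by apply: leq_ltn_trans Hpos _; rewrite ltn_exp2l //; lia.
have logk : logn 2 pos <= k.
  by rewrite -(leq_exp2l _ _ (ltnSn 1)) (leq_trans _ Hpos) // dvdn_leq // pfactor_dvdnn.
(* [i] levels have been merged, and the registers are ready to test whether a block of level [i.+1]
   ends here. The loop stops at [i = logn 2 pos], which is at most [k]. *)
pose I r m := exists i, [/\ i.+1 + r = k.+2, i <= logn 2 pos &
  m = mem_of n al y 1 pos (hgt st) 0 (2 ^ i.+1) (pos %% 2 ^ i.+1) (merges i pos st)].
have [] := @while_exec K L k (TestEq (Reg 9) (Cst 0)) merge_step I L0 Hc _ _ _ _ k.+1
  (mem_of n al y 1 pos (hgt st) 0 2 (pos %% 2) st).
- by rewrite /= /bits trunc_log0; lia.
- move=> r m' [i [Hi Hil ->]]; apply: mem_of_bounded; last first.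
  + exact: leq_trans (size_merges _ _ _) Hs.
  + by apply: (enc_bounded pp (wf_merges _ _ Hw)); rewrite ?hgt_merges.
  have Hi2 : 2 ^ i.+1 < 2 ^ L by rewrite ltn_exp2l //; lia.
  rewrite Hn Hp (ltn_trans Hal Hp) Hy one HposL Hh expn_gt0 Hi2 /=.
  exact: leq_ltn_trans (leq_mod _ _) HposL.
- move=> m' [i [Hi Hil ->]]; rewrite /= /Defs.get /=; lia.
- move=> r m' [i [Hi Hil ->]] Ht; have E0 : pos %% 2 ^ i.+1 = 0.
    by move: Ht; rewrite /= /Defs.get /= => /eqP.
  have Hd : 2 ^ i.+1 %| pos by rewrite /dvdn E0.
  exists i.+1; split; [lia | by rewrite -dvdn_exp2_logn |].
  rewrite E0 den_merge ?(wf_merges _ _ Hw) //; last exact: dvdn_leq.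
  by have := merges_block st (i := i) (pos := pos.-1); rewrite prednK // => ->.
- by exists 0; rewrite /merges min0n.
move=> m' [E [r [i [Hi Hil Em]]]] Ht; move: E; rewrite Em.
have -> : i = logn 2 pos.
  apply/eqP; rewrite eqn_leq Hil leqNgt -dvdn_exp2_logn //; apply: contra Ht.
  by rewrite Em /= /Defs.get /=.
by rewrite /merges minnn (minn_idPr logk).
Qed.

Lemma seqs_nil_exec K L k m : 0 < L -> cheap K Skip -> bounded L (Qsize k) m ->
  exec_within (step_time K L) (run_space K L k) (seqs [::]) m m.
Proof. move=> L0 Hc Hm; exact: (cheap_exec L0 Hc Hm). Qed.

Definition dead (L k : nat) (m : memory) : Prop :=
  [/\ Defs.get m 4 = 0, bounded L (Qsize k) m & size (regs m) = 16].

Definition represents (p n al L k pos : nat) (o : option (gstack 'F_p)) (m : memory) : Prop :=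
  if o is Some st then m = mem_of n al 0 1 pos (hgt st) 0 0 0 st else dead L k m.

(** Two loops of at most [k.+2] steps each, for the power and for the merges, and a few single
    steps. *)
Definition letter_time (K L k : nat) : nat := (k.+2.*2 + 8) * step_time K L.

Lemma exec_within_time t t' s c m m' : t <= t' ->
  exec_within t s c m m' -> exec_within t' s c m m'.
Proof. by move=> Ht; apply: exec_within_mono. Qed.

Lemma process_letter_exec p n al y pos k L K (st : gstack 'F_p) :
  prime p -> word_bound p n al k L -> 10 <= K -> all_cheap K ->
  wf pos st -> hgt st <= pos -> pos < 2 ^ k -> size st <= k.+1 ->
  exists2 m', exec_within (letter_time K L k) (run_space K L k) process_letter
      (mem_of n al (letter_code y) 1 pos (hgt st) 0 0 0 st) m' &
    represents n al L k pos.+1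
      (omap (merges k pos.+1) (gread (al%:R)%R pos st y)) m'.
Proof.
have triple W : W + W + W = 3 * W by lia.
have time_le W j : W + (j * W + W) + W <= j * W + 3 * W by lia.
move=> pp Hwb HK [CS [_ [Cp [Cpow [Cr [Cm [Cf _]]]]]]] Hw Hh Hpos Hs.
have /and4P[Hn Hp Hal HkL] := Hwb.
have L0 : 0 < L by lia.
have Hk2 : 2 ^ k.+1 < 2 ^ L by rewrite ltn_exp2l //; lia.
have Hk1 : 2 ^ k < 2 ^ k.+1 by rewrite ltn_exp2l.
have four : 4 <= 2 ^ L by rewrite (_ : 4 = 2 ^ 2) // leq_exp2l //; lia.
have Hy : letter_code y < 2 ^ L by apply: leq_trans four; case: y.
have one : 1 < 2 ^ L by exact: leq_trans four.
have two : 2 < 2 ^ L by exact: leq_trans four.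
have zero : 0 < 2 ^ L by exact: leq_trans four.
have HhL : hgt st < 2 ^ L by lia.
have HposL : pos < 2 ^ L by lia.
have He := enc_bounded pp Hw Hp HposL HhL.
have halL : al < 2 ^ L by apply: ltn_trans Hp.
set m0 := mem_of _ _ _ _ _ _ _ _ _ _.
have B0 : bounded L (Qsize k) m0.
  apply: mem_of_bounded => //; last lia.
  by rewrite Hn Hp halL Hy HposL HhL; lia.
have E1 := cheap_exec L0 Cp B0; rewrite den_prepare in E1.
have Hup : hgt st + upstep y <= pos.+1 by case: upstep; lia.
have HpL : pos.+1 < 2 ^ L by lia.
have HH : hgt st + upstep y < 2 ^ k.+1 by lia.
have Hsk : size st <= k + 2 by lia.
have [A HA E2] := power_loop pp Hwb HK Cpow (wf_leq (leqnSn pos) Hw) HhL HpL Hy HH Hsk erefl.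
set m2 := mem_of _ _ _ _ _ _ A _ _ _ in E2.
have B2 : bounded L (Qsize k) m2.
  apply: mem_of_bounded => //.
  rewrite Hn Hp halL Hy (ltn_trans HA Hp) expn_gt0 (ltn_trans (ltn_pmod _ (prime_gt0 pp)) Hp); lia.
have E3 := cheap_exec L0 Cr B2.
have alive_const : test_const alive <= K by rewrite /= (_ : bits 1 = 1) //; lia.
have alive0 : eval_test m0 alive by [].
suff [m3 E Hm3] : exists2 m3, exec_within (k.+2 * step_time K L + 3 * step_time K L) (run_space K L k)
    (seqs [:: If alive (Seq (While (TestEq (Reg 9) (Cst 0)) merge_step) finish_letter) Skip])
    (den read_step m2) m3 &
    represents n al L k pos.+1 (omap (merges k pos.+1) (gread (al%:R)%R pos st y)) m3.
  exists m3 => //; apply: (@exec_within_time (step_time K L + (step_time K L +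
    (k.+2 * step_time K L + (step_time K L + (k.+2 * step_time K L + 3 * step_time K L)))))).
    by rewrite /letter_time; move: (step_time K L) => W; nia.
  apply: if_exec => //; rewrite alive0.
  apply: exec_within_seq E1 _; apply: exec_within_seq E2 _; exact: exec_within_seq E3 E.
have := den_read n al y A pp Hw; rewrite -/m2; cbv zeta.
case Eg: (gread (al%:R)%R pos st y) => [s|]; last first.
  move=> [s [Hsub Hsz] ->].
  set m3 := mem_of _ _ _ _ _ _ _ _ _ _.
  have B3 : bounded L (Qsize k) m3.
    apply: mem_of_bounded; last exact: leq_trans Hsk.
      by rewrite Hn Hp halL Hy zero two HpL (leq_ltn_trans (leq_mod _ _) HpL) (leq_ltn_trans (leq_pred _) HhL).
    by apply/allP => v /Hsub; apply: (allP He).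
  exists m3; last by split.
  apply: (@exec_within_time (step_time K L + step_time K L + step_time K L)).
    exact: (leq_trans (eq_leq (triple _)) (leq_addl _ _)).
  apply: exec_within_seq; last exact: seqs_nil_exec.
  apply: if_exec => //; exact: (cheap_exec L0 CS B3).
move=> ->; have Hws := wf_gread Eg Hw; have Hss := size_gread Eg; have Hhs := hgt_gread Eg Hw.
have Hhs' : hgt s <= pos.+1.
  by apply: leq_trans (leq_trans (leq_addr _ _) (eq_leq Hhs)) _; rewrite -addn1 leq_add // leq_b1.
have Hsk2 : size s <= k + 2 by rewrite (leq_trans Hss) // addn2 ltnS.
set m3 := mem_of _ _ _ _ _ _ _ _ _ _.
have HsL : hgt s < 2 ^ L by exact: leq_ltn_trans Hhs' HpL.
have Hes := enc_bounded pp Hws Hp HpL HsL.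
have B3 : bounded L (Qsize k) m3.
  apply: mem_of_bounded => //.
  by rewrite Hn Hp halL Hy one HpL HsL zero two (leq_ltn_trans (leq_mod _ _) HpL).
have E4 := merge_loop pp Hwb HK Cm Hws HsL (Hpos : 0 < pos.+1 <= 2 ^ k) Hy Hsk2.
set m4 := mem_of _ _ _ _ _ _ _ _ _ (merges _ _ _) in E4.
have logk : 2 ^ logn 2 pos.+1 <= pos.+1 by rewrite dvdn_leq // pfactor_dvdnn.
have B4 : bounded L (Qsize k) m4.
  apply: mem_of_bounded; last exact: leq_trans (size_merges _ _ _) Hsk2.
    rewrite Hn Hp halL Hy HsL one HpL zero (leq_ltn_trans (leq_mod _ _) HpL) /= andbT.
    by apply: leq_ltn_trans _ Hk2; rewrite !expnS leq_mul2l (leq_trans logk).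
  by apply: (enc_bounded pp (wf_merges _ _ Hws)); rewrite ?hgt_merges.
have E5 := cheap_exec L0 Cf B4; rewrite den_finish in E5.
set m5 := mem_of _ _ _ _ _ _ _ _ _ _ in E5.
exists m5; last by rewrite /represents /= hgt_merges.
have B5 : bounded L (Qsize k) m5.
  apply: mem_of_bounded; last exact: leq_trans (size_merges _ _ _) Hsk2.
    by rewrite Hn Hp halL HsL HpL one zero.
  by apply: (enc_bounded pp (wf_merges _ _ Hws)); rewrite ?hgt_merges.
apply: (@exec_within_time (step_time K L + (k.+2 * step_time K L + step_time K L) + step_time K L)).
  exact: time_le.
apply: exec_within_seq; last exact: seqs_nil_exec.
apply: if_exec => //; exact: exec_within_seq E4 E5.
Qed.

(** * Skipping the padding *)

Lemma logn_odd pos : ~~ odd pos -> logn 2 pos.+1 = 0.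
Proof.
by move=> Ho; apply/eqP; rewrite lognE /= dvdn2 /= negbK (negPf Ho).
Qed.

Lemma merges_odd (R : nzRingType) k pos (st : gstack R) : ~~ odd pos -> merges k pos.+1 st = st.
Proof. by move=> Ho; rewrite /merges logn_odd // minn0. Qed.

Lemma nilp_merges (R : nzRingType) i p (st : gstack R) : nilp (merges i p st) = nilp st.
Proof.
rewrite /merges; elim: (iota _ _) st => //= j l IH st; rewrite IH.
by case: st => [|[[h2 l2] f2] [|[[h1 l1] f1] st]] //=; case: ifP.
Qed.

(** From an even position the upstep lands on an odd one, where nothing is merged, so the next
    downstep empties its item with hash 0. Only emptiness is claimed, as block ends in the padding
    may still join older items. *)
Lemma grun_pads (R : nzRingType) (al : R) k pos st m : ~~ odd pos -> exists2 s,
  grun al k pos st (flatten (nseq m [:: La; La'])) = Some s & nilp s = nilp st.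
Proof.
elim: m pos st => [|m IH] pos st Ho /=; first by exists st.
rewrite (merges_odd _ _ Ho) /= /gread /= (_ : hgt (_ :: st) = (hgt st).+1) // subrr eqxx /=.
have [|s -> Hs] := IH pos.+2 (merges k pos.+2 st); first by rewrite /= negbK.
by exists s => //; rewrite Hs nilp_merges.
Qed.

Lemma mirror_pads m : mirror (flatten (nseq m [:: La; La'])) = flatten (nseq m [:: La; La']).
Proof.
have comm j : flatten (nseq j [:: La; La']) ++ [:: La; La'] = [:: La; La'] ++ flatten (nseq j [:: La; La']).
  by elim: j => //= j ->.
by elim: m => // m IH; rewrite [flatten _]/= -[La :: _]/([:: La; La'] ++ _) mirror_cat IH comm.
Qed.

Lemma dead_put L k m r v : r < 16 -> r != 4 -> v < 2 ^ L -> dead L k m -> dead L k (put m r v).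
Proof.
move=> Hr Hr4 Hv [H1 H2 H3].
have Hz : size (regs (put m r v)) = 16 by rewrite /= size_set_nth H3 (maxn_idPr Hr).
split=> //; first by rewrite /Defs.get /= nth_set_nth /= eq_sym (negPf Hr4).
case/andP: H2; rewrite /bounded all_cat Hz H3 => /andP[Ha Hb] ->.
by rewrite all_cat Hb !andbT; apply: all_set_nth => //; rewrite expn_gt0.
Qed.

Lemma dead_deliver L k m y : 3 <= L -> dead L k m -> dead L k (deliver m y).
Proof.
move=> HL; apply: dead_put => //; apply: (@leq_trans (2 ^ 3)); first by case: y.
by rewrite leq_exp2l.
Qed.

Lemma dead_flip L k m : 3 <= L -> dead L k m -> dead L k (den flip_letter m).
Proof.
move=> HL H; have H4 : 4 < 2 ^ L by apply: (@leq_trans (2 ^ 3)); rewrite ?leq_exp2l.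
by rewrite /=; do ?[case: ifP => _]; apply: dead_put => //; apply: leq_trans H4.
Qed.

Lemma dead_not_alive L k m : dead L k m -> eval_test m alive = false.
Proof. by case=> H _ _; rewrite /= H. Qed.

Lemma alive_const K : 10 <= K -> test_const alive <= K.
Proof. by move=> HK; rewrite /= (_ : bits 1 = 1) //; lia. Qed.

Lemma dead_process L k K m : 0 < L -> 10 <= K -> all_cheap K -> dead L k m ->
  exec_within (letter_time K L k) (run_space K L k) process_letter m m.
Proof.
move=> L0 HK [CS _] H; apply: (@exec_within_time (step_time K L + step_time K L)).
  rewrite /letter_time; nia.
have [_ HB _] := H; apply: if_exec => //; first exact: alive_const.
by rewrite (dead_not_alive H); exact: (cheap_exec L0 CS HB).
Qed.

(** * Passes over the input *)

Definition pass_time (K L k : nat) : nat := step_time K L + letter_time K L k.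

(** Common interface of the two passes: [phi] is the identity in the first and [flip] in the
    second. *)
Definition letter_command (K L k p n al : nat) (phi : letter -> letter) (c : cmd) : Prop :=
  (forall y pos (st : gstack 'F_p), wf pos st -> hgt st <= pos -> pos < 2 ^ k ->
     size st <= k.+1 ->
     exists2 m', exec_within (pass_time K L k) (run_space K L k) c
         (deliver (mem_of n al 0 1 pos (hgt st) 0 0 0 st) y) m' &
       represents n al L k pos.+1
         (omap (merges k pos.+1) (gread (al%:R)%R pos st (phi y))) m') /\
  (forall m y, dead L k m -> exists2 m',
     exec_within (pass_time K L k) (run_space K L k) c (deliver m y) m' & dead L k m').

Lemma process_letter_command p n al k L K : prime p -> word_bound p n al k L ->
  10 <= K -> all_cheap K -> letter_command K L k p n al id process_letter.
Proof.
move=> pp Hwb HK HC; have /and4P[_ _ _ HkL] := Hwb; split=> [y pos st Hw Hh Hp Hs|m y Hm].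
  have [m' E Hm'] := process_letter_exec y pp Hwb HK HC Hw Hh Hp Hs.
  by exists m' => //; apply: exec_within_time E; rewrite leq_addl.
have L3 : 3 <= L by lia.
exists (deliver m y); last exact: dead_deliver.
apply: (exec_within_time (leq_addl _ _)); apply: dead_process => //; first lia.
exact: dead_deliver.
Qed.

Lemma flip_letter_command p n al k L K : prime p -> word_bound p n al k L ->
  10 <= K -> all_cheap K -> letter_command K L k p n al flip (Seq flip_letter process_letter).
Proof.
move=> pp Hwb HK HC; have /and4P[Hn Hp Hal HkL] := Hwb.
have Cfl : cheap K flip_letter by case: HC => _ [_ [_ [_ [_ [_ [_ [H _]]]]]]].
have L0 : 0 < L by lia.
have L3 : 3 <= L by lia.
split=> [y pos st Hw Hh Hpos Hs|m y Hm].
  have [m' E Hm'] := process_letter_exec (flip y) pp Hwb HK HC Hw Hh Hpos Hs.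
  exists m' => //; apply: exec_within_seq E.
  rewrite -(den_flip _ _ y); apply: (cheap_exec L0 Cfl).
  have Hk : 2 ^ k < 2 ^ L by rewrite ltn_exp2l //; lia.
  have HpL := ltn_trans Hpos Hk.
  apply: mem_of_bounded; last lia.
    have E8 : 8 <= 2 ^ L by rewrite (_ : 8 = 2 ^ 3) // leq_exp2l.
    have one : 1 < 2 ^ L by apply: leq_trans E8.
    have zero : 0 < 2 ^ L by apply: leq_trans E8.
    have Hy : letter_code y < 2 ^ L by apply: leq_trans E8; case: (y).
    by rewrite Hn Hp (ltn_trans Hal Hp) Hy one zero HpL (leq_ltn_trans Hh HpL).
  apply: (enc_bounded pp Hw) => //; exact: leq_ltn_trans HpL.
have Hd := dead_deliver y L3 Hm; have [_ Hb _] := Hd; have Hf := dead_flip L3 Hd.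
exists (den flip_letter (deliver m y)) => //.
apply: exec_within_seq (dead_process L0 HK HC Hf); exact: (cheap_exec L0 Cfl).
Qed.

Lemma feed_dead K L k p n al phi c w m : letter_command K L k p n al phi c -> dead L k m ->
  exists2 ms, feed (pass_time K L k) (run_space K L k) c m w ms & dead L k (last m ms).
Proof.
move=> [_ Hc]; elim: w m => [|y w IH] m Hm; first by exists [::]; first exact: feed_nil.
have [m1 E /IH [ms F Hl]] := Hc m y Hm; exists (m1 :: ms) => //; exact: feed_cons E F.
Qed.

(** [a] is 0 in the first pass and the length of the skipped padding in the second. *)
Lemma feed_letters K L k p n al phi c X w a m : letter_command K L k p n al phi c ->
  a + size w <= 2 ^ k -> size X = 2 ^ k -> map phi w = take (size w) (drop a X) ->
  represents n al L k a (grun (al%:R : 'F_p)%R k 0 [::] (take a X)) m ->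
  exists ms, [/\ feed (pass_time K L k) (run_space K L k) c m w ms, size ms = size w &
    forall d j, j <= size w -> represents n al L k (a + j)
      (grun (al%:R : 'F_p)%R k 0 [::] (take (a + j) X)) (nth d (m :: ms) j)].
Proof.
move=> Hc; elim: w a m => [|y w IH] a m Ha HX Hw Hm.
  exists [::]; split=> // [|d j]; first exact: feed_nil.
  by rewrite leqn0 => /eqP->; rewrite addn0.
have aX : a < size X by rewrite HX; move: Ha => /=; lia.
move: Hw; rewrite (drop_nth La) //= => -[Hy Hw].
have Ha1 : a.+1 + size w <= 2 ^ k by move: Ha => /=; lia.
have St : grun (al%:R : 'F_p)%R k 0 [::] (take a.+1 X) =
  obind (fun s => omap (merges k a.+1) (gread (al%:R)%R a s (phi y)))
    (grun (al%:R)%R k 0 [::] (take a X)).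
  by rewrite (take_nth La aX) -Hy grun_rcons add0n size_takel // ltnW.
have [m1 E Hm1] : exists2 m1, exec_within (pass_time K L k) (run_space K L k) c (deliver m y) m1 &
    represents n al L k a.+1 (grun (al%:R : 'F_p)%R k 0 [::] (take a.+1 X)) m1.
  rewrite St; case Es: grun Hm => [st|] /= Hm; last by have [_ H] := Hc; exact: H.
  rewrite Hm; have [H _] := Hc; apply: H.
  - by have := wf_grun Es isT; rewrite add0n size_takel // ltnW.
  - have := hgt_grun Es isT; have := count_size upstep (take a X).
    by rewrite size_takel ?(ltnW aX) // /hgt /=; lia.
  - by rewrite -HX.
  - by apply: size_grun Es; rewrite size_takel ?(ltnW aX) // -HX ltnW.
have [ms [F Hs Hms]] := IH _ _ Ha1 HX Hw Hm1.
exists (m1 :: ms); split; [exact: feed_cons E F | by rewrite /= Hs |].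
move=> d [|j] Hj; first by rewrite addn0.
by rewrite addnS -addSn; apply: Hms.
Qed.

Lemma end_first_pass_exec p n al k L K st m : 1 < n -> k = levels n ->
  prime p -> word_bound p n al k L -> 10 <= K -> all_cheap K ->
  wf n st -> hgt st <= n -> size st <= k.+1 ->
  represents n al L k n (Some st : option (gstack 'F_p)) m ->
  exists2 m', exec_within (pass_time K L k) (run_space K L k) end_first_pass m m' &
    represents n al L k (npad n) (if nilp st then Some st else None) m'.
Proof.
move=> n1 Hk pp Hwb HK HC Hw Hh Hs Hm.
have /and4P[Hn Hp Hal HkL] := Hwb.
have L0 : 0 < L by lia.
have E8 : 8 <= 2 ^ L by rewrite (_ : 8 = 2 ^ 3) // leq_exp2l //; lia.
have one : 1 < 2 ^ L by apply: leq_trans E8.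
have zero : 0 < 2 ^ L by apply: leq_trans E8.
have halL := ltn_trans Hal Hp.
have hL := leq_ltn_trans Hh Hn.
have Hsk : size st <= k + 2 by apply: leq_trans Hs _; rewrite addn2 leqnSn.
have He := enc_bounded pp Hw Hp Hn hL.
have Hb : bounded L (Qsize k) m.
  by rewrite Hm; apply: mem_of_bounded => //; rewrite Hn Hp halL one zero hL.
have Halive : eval_test m alive by rewrite Hm.
have CA : test_const alive <= K by exact: alive_const.
have CE : test_const TestEmpty <= K by apply: leq_trans HK.
case: HC => C0 [_ [_ [_ [_ [_ [_ [_ [C1 [C2 [C3 [C4 _]]]]]]]]]]].
have fits W : W + (W + (W + (k.+1 * W + (W + W)))) <= W + (k.+2.*2 + 8) * W by nia.
case: st Hm Hw Hh Hs Hsk hL He => [|it st] Hm Hw Hh Hs Hsk hL He; last first.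
  exists (den (assign 4 (Cst 0)) m).
    apply: (@exec_within_time (step_time K L + (step_time K L + step_time K L))).
      by apply: leq_trans (fits _); rewrite !leq_add2l leq_addr.
    apply: if_exec => //; rewrite Halive; apply: if_exec => //.
    have -> : eval_test m TestEmpty = false by rewrite Hm /=; case: (it) => [[h l] f].
    exact: (cheap_exec L0 C4 Hb).
  have Hsz : size (regs m) = 16 by rewrite Hm.
  rewrite /= /dead; split; [by rewrite Hm | | by rewrite Hm].
  by rewrite Hm; apply: (@mem_of_bounded p n al 0 0 n (hgt (it :: st)) 0 0 0) => //;
    rewrite Hn Hp halL zero hL.
have [lo hi] : 2 ^ k.-1 < n /\ n <= 2 ^ k by have := levels_bounds n1; rewrite -Hk => /andP.
pose mA A := mem_of n al 0 1 n 0 A 0 0 ([::] : gstack 'F_p).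
have BA A : A < 2 ^ L -> bounded L (Qsize k) (mA A).
  by move=> HA; apply: mem_of_bounded => //; rewrite Hn Hp halL one zero HA.
have E1 := cheap_exec L0 C1 Hb.
have EA : den (assign 7 (Cst 1)) m = mA 1 by rewrite Hm.
rewrite EA in E1.
pose I r m' := exists2 i, i + r = k & m' = mA (2 ^ i).
have Hpow i : i <= k -> 2 ^ i < 2 ^ L by move=> Hi; rewrite ltn_exp2l //; lia.
have [] := @while_exec K L k (TestLt (Reg 7) (Reg 0)) (Op 7 Mul (Reg 7) (Cst 2)) I L0 C2 _ _ _ _ k (mA 1).
- by apply: leq_trans HK.
- by move=> r m' [i Hi ->]; apply/BA/Hpow; rewrite -Hi leq_addr.
- by move=> m' [i + ->]; rewrite addn0 => ->; rewrite /= /Defs.get /= -leqNgt.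
- move=> r m' [i Hi ->] _; exists i.+1; first by rewrite addSnnS.
  by rewrite /mA expnSr.
- by exists 0.
move=> m2 [E2 [r [i Hi Em2]] Ht].
(* The loop stops at the first power of two not below [n], and [2 ^ k.-1 < n]. *)
have Hik : i = k.
  apply/eqP; rewrite eqn_leq -{1}Hi leq_addr /= leqNgt; apply: contra Ht => Hlt.
  rewrite Em2 /= /Defs.get /=; apply: leq_ltn_trans lo.
  by rewrite leq_exp2l //; lia.
rewrite Em2 Hik in E2.
have E3 := cheap_exec L0 C3 (BA _ (Hpow k (leqnn k))).
have EB : den (seqs [:: Op 5 Defs.Sub (Reg 7) (Reg 0); assign 7 (Cst 0)]) (mA (2 ^ k)) =
    mem_of n al 0 1 (npad n) 0 0 0 0 ([::] : gstack 'F_p).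
  by rewrite /npad -Hk.
rewrite EB in E3.
exists (mem_of n al 0 1 (npad n) 0 0 0 0 ([::] : gstack 'F_p)) => //.
apply: (@exec_within_time (step_time K L + (step_time K L + (step_time K L +
    (k.+1 * step_time K L + (step_time K L + step_time K L)))))); first exact: fits.
apply: if_exec => //; rewrite Halive; apply: if_exec => //.
have -> : eval_test m TestEmpty = true by rewrite Hm.
apply: exec_within_seq E1 _; apply: exec_within_seq E2 _.
exact: exec_within_time (leq_addl _ _) E3.
Qed.

Lemma end_first_pass_dead K L k m : 0 < L -> 10 <= K -> all_cheap K -> dead L k m ->
  exec_within (pass_time K L k) (run_space K L k) end_first_pass m m.
Proof.
move=> L0 HK [CS _] H; apply: (@exec_within_time (step_time K L + step_time K L)).
  rewrite /pass_time /letter_time; nia.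
have [_ HB _] := H; apply: if_exec => //; first exact: alive_const.
by rewrite (dead_not_alive H); exact: (cheap_exec L0 CS HB).
Qed.

Lemma represents_holds p n al k L X j m : 0 < k -> size X = 2 ^ k -> j <= 2 ^ k ->
  (exists pos, represents n al L k pos (grun (al%:R : 'F_p)%R k 0 [::] (take j X)) m) ->
  holds_stack (Block al (take j X) k 0 [::] : status p) m.
Proof.
move=> k0 HX Hj [pos]; rewrite Block_prefix //; case: grun => [st|] //= Hm.
by case: ifP => _ /=; rewrite encode_to_stack Hm.
Qed.

Lemma represents_accepting p n al L k pos (o : option (gstack 'F_p)) m :
  represents n al L k pos o m -> accepting m = (o != None).
Proof. by case: o => [st ->|[H _ _]] //; rewrite /accepting H. Qed.

Definition run_spec (p al : nat) (x : word) (tr : seq (seq memory)) (m' : memory) : Prop :=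
  let snap k j := nth m' (nth [::] tr k) j in
  [/\ ~~ odd (size x) -> forall j, j <= size x ->
        holds_stack (pass1 p al x j) (snap 0 j),
      ~~ odd (size x) -> pass1_ok p al x -> forall j, j <= size x ->
        holds_stack (pass2 p al x (npad (size x) + j)) (snap 1 j) &
      accepting m' = algorithm3 p al x].

(** Writing register 15 extends the register file to the sixteen entries of [mem_of]; an odd length
    sets the verdict to 0 from the start. *)
Lemma den_preprocessing p n al :
  den preprocessing (initial_memory n p al) =
  mem_of n al 0 (~~ odd n) 0 0 0 0 0 ([::] : gstack 'F_p).
Proof. by rewrite /mem_of /= /Defs.get /= modn2; case: odd. Qed.

Lemma run_two_passes t s x m ms1 m1 ms2 :
  feed t s process_letter m x ms1 -> exec_within t s end_first_pass (last m ms1) m1 ->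
  feed t s (Seq flip_letter process_letter) m1 (rev x) ms2 ->
  exec_within t s Skip (last m1 ms2) (last m1 ms2) ->
  run_passes t s x (passes program) m [:: m :: ms1; m1 :: ms2] (last m1 ms2).
Proof.
move=> F1 E1 F2 E2.
apply: (@run_passes_cons t s x (Pass LeftToRight process_letter end_first_pass) _ _ _ _ _ _ F1 E1).
apply: (@run_passes_cons t s x (Pass RightToLeft (Seq flip_letter process_letter) Skip) _ _ _ _ _ _ F2 E2).
exact: run_passes_nil.
Qed.

Lemma last_nth_size (T : Type) (d a : T) s : last a s = nth d (a :: s) (size s).
Proof. by rewrite (last_nth d). Qed.

Lemma run_program p al K L x : 1 < size x -> prime p ->
  word_bound p (size x) al (levels (size x)) L -> 10 <= K -> all_cheap K ->
  exists tr m', run program (pass_time K L (levels (size x)))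
    (run_space K L (levels (size x))) p al x tr m' /\ run_spec p al x tr m'.
Proof.
set n := size x; set k := levels n => n1 pp Hwb HK HC.
have k0 : 0 < k by exact: levels_gt0.
have [lo hi] : 2 ^ k.-1 < n /\ n <= 2 ^ k by have := levels_bounds n1 => /andP.
have /and4P[Hn Hp Hal HkL] := Hwb.
have L0 : 0 < L by lia.
have E8 : 8 <= 2 ^ L by rewrite (_ : 8 = 2 ^ 3) // leq_exp2l //; lia.
have one : 1 < 2 ^ L by apply: leq_trans E8.
have zero : 0 < 2 ^ L by apply: leq_trans E8.
have halL := ltn_trans Hal Hp.
have [CS [CP _]] := HC.
have HcP : letter_command K L k p n al id process_letter by exact: process_letter_command.
have HcF : letter_command K L k p n al flip (Seq flip_letter process_letter).
  exact: flip_letter_command.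
have Binit : bounded L (Qsize k) (initial_memory n p al).
  by rewrite /bounded /= Hn Hp halL /= /Qsize; lia.
have Eini : exec_within (pass_time K L k) (run_space K L k) preprocessing (initial_memory n p al)
    (mem_of n al 0 (~~ odd n) 0 0 0 0 0 ([::] : gstack 'F_p)).
  rewrite -den_preprocessing; apply: exec_within_time (leq_addr _ _) _.
  exact: (cheap_exec L0 CP Binit).
set m0 := mem_of _ _ _ _ _ _ _ _ _ _ in Eini.
(* Shared by the rejections before the second pass: odd length, failure in the first pass, and a
   nonempty stack at its end. *)
have from_dead m1 : dead L k m1 -> exists2 ms2,
    feed (pass_time K L k) (run_space K L k) (Seq flip_letter process_letter) m1 (rev x) ms2 &
    exec_within (pass_time K L k) (run_space K L k) Skip (last m1 ms2) (last m1 ms2) /\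
    accepting (last m1 ms2) = false.
  move=> Hd; have [ms2 F2 Hl] := feed_dead (rev x) HcF Hd; exists ms2 => //.
  have [H4 Hb _] := Hl; split; last by rewrite /accepting H4.
  exact: exec_within_time (leq_addr _ _) (cheap_exec L0 CS Hb).
have [n2|n2] := boolP (odd n).
  have D0 : dead L k m0.
    rewrite /m0 n2; split=> //; apply: mem_of_bounded => //.
    by rewrite Hn Hp halL zero.
  have [ms1 F1 D1] := feed_dead x HcP D0.
  have [ms2 F2 [E2 Hacc]] := from_dead _ D1.
  have E1 := end_first_pass_dead L0 HK HC D1.
  exists [:: m0 :: ms1; last m0 ms1 :: ms2], (last (last m0 ms1) ms2); split.
    by exists m0 => //; apply: run_two_passes F1 E1 F2 E2.
  by split; [rewrite -/n n2 | rewrite -/n n2 | rewrite Hacc /algorithm3 -/n n2].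
have HX := size_padded n1 n2; set X := padded x in HX; rewrite -/n -/k in HX.
have HXm : size (mirror X) = 2 ^ k by rewrite size_mirror.
have takeX j : j <= n -> take j X = take j x by move=> Hj; rewrite /X /padded takel_cat.
have R0 : represents n al L k 0 (grun (al%:R : 'F_p)%R k 0 [::] (take 0 X)) m0.
  by rewrite take0 /m0 n2.
have [ms1 [F1 Hs1 P1]] := @feed_letters K L k p n al id process_letter X x 0 m0 HcP
  hi HX (etrans (map_id x) (esym (etrans (congr1 _ (drop0 X)) (etrans (takeX _ (leqnn n)) (take_size x))))) R0.
have Rn : represents n al L k n (grun (al%:R : 'F_p)%R k 0 [::] x) (last m0 ms1).
  have := P1 m0 n (leqnn n).
  by rewrite add0n takeX // take_oversize // (last_nth_size m0) Hs1.
have pass1_holds d j : j <= n -> holds_stack (pass1 p al x j) (nth d (m0 :: ms1) j).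
  move=> Hj; apply: (@represents_holds p n al k L X j _ k0 HX); first exact: leq_trans hi.
  by exists (0 + j); exact: P1.
have npadn : npad n + n = 2 ^ k by rewrite /npad subnK.
have ok1 : pass1_ok p al x = (if grun (al%:R : 'F_p)%R k 0 [::] x is Some st then nilp st else false).
  rewrite pass1_okE // -/n -/k /padded grun_cat; case: grun => [st|] //=.
  have [s -> Hs] := grun_pads (al%:R : 'F_p)%R k st (npad (size x))./2 n2.
  by rewrite -Hs; case: (s).
case Ex: (grun (al%:R : 'F_p)%R k 0 [::] x) => [st|]; rewrite Ex in Rn ok1; last first.
  have [ms2 F2 [E2 Hacc]] := from_dead _ Rn.
  have E1 := end_first_pass_dead L0 HK HC Rn.
  exists [:: m0 :: ms1; last m0 ms1 :: ms2], (last (last m0 ms1) ms2); split.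
    by exists m0 => //; apply: run_two_passes F1 E1 F2 E2.
  split=> [_ j Hj|_|]; [exact: pass1_holds | by rewrite ok1 |].
  by rewrite Hacc /algorithm3 ok1 andbF.
have Hwst : wf n st by have := wf_grun Ex isT.
have Hhst : hgt st <= n.
  by have := hgt_grun Ex isT; have := count_size upstep x; rewrite -/n /hgt /=; lia.
have Hsst : size st <= k.+1 by apply: size_grun Ex.
have [m1 E1 R1] := end_first_pass_exec n1 (erefl k) pp Hwb HK HC Hwst Hhst Hsst Rn.
case Enil: (nilp st) R1 ok1 => R1 ok1; last first.
  have [ms2 F2 [E2 Hacc]] := from_dead _ R1.
  exists [:: m0 :: ms1; m1 :: ms2], (last m1 ms2); split.
    by exists m0 => //; apply: run_two_passes F1 E1 F2 E2.
  split=> [_ j Hj|_|]; [exact: pass1_holds | by rewrite ok1 |].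
  by rewrite Hacc /algorithm3 ok1 andbF.
have mX : mirror X = flatten (nseq (npad n)./2 [:: La; La']) ++ mirror x.
  by rewrite /X /padded mirror_cat mirror_pads.
have size_pad : size (flatten (nseq (npad n)./2 [:: La; La'])) = npad n.
  by rewrite size_pads npadE.
have Epad : grun (al%:R : 'F_p)%R k 0 [::] (take (npad n) (mirror X)) = Some st.
  rewrite mX takel_cat ?size_pad // take_oversize ?size_pad //.
  have [s -> Hs] := grun_pads (al%:R : 'F_p)%R k [::] (npad n)./2 (isT : ~~ odd 0).
  by move/nilP: Enil Hs => ->; case: (s).
have [ms2 [F2 Hs2 P2]] : exists ms2,
    [/\ feed (pass_time K L k) (run_space K L k) (Seq flip_letter process_letter) m1 (rev x) ms2,
        size ms2 = size (rev x) & forall d j, j <= size (rev x) ->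
        represents n al L k (npad n + j)
          (grun (al%:R : 'F_p)%R k 0 [::] (take (npad n + j) (mirror X))) (nth d (m1 :: ms2) j)].
  apply: (feed_letters HcF) => //; first by rewrite size_rev -/n npadn.
    by rewrite mX drop_size_cat // take_oversize // size_mirror size_rev.
  by rewrite Epad.
rewrite size_rev -/n in Hs2 P2.
have Rl : represents n al L k (2 ^ k) (grun (al%:R : 'F_p)%R k 0 [::] (mirror X)) (last m1 ms2).
  have := P2 m1 n (leqnn n).
  by rewrite npadn take_oversize ?HXm // (last_nth_size m1) Hs2.
have E2 : exec_within (pass_time K L k) (run_space K L k) Skip (last m1 ms2) (last m1 ms2).
  apply: exec_within_time (leq_addr _ _) _; apply: (cheap_exec L0 CS).
  case E: grun Rl => [s|] /= Rl; last by case: Rl.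
  have Hk2 : 2 ^ k < 2 ^ L by rewrite ltn_exp2l //; lia.
  have Hws : wf (2 ^ k) s by have := wf_grun E isT; rewrite HXm.
  have Hhs : hgt s <= 2 ^ k.
    by have := hgt_grun E isT; have := count_size upstep (mirror X); rewrite HXm /hgt /=; lia.
  have HhL := leq_ltn_trans Hhs Hk2.
  rewrite Rl; apply: mem_of_bounded; first by rewrite Hn Hp halL zero one Hk2 HhL.
    exact: enc_bounded Hws Hp Hk2 HhL.
  have HXle : size (mirror X) <= 2 ^ k by rewrite HXm.
  by apply: leq_trans (size_grun HXle E) _; rewrite addn2 leqnSn.
exists [:: m0 :: ms1; m1 :: ms2], (last m1 ms2); split.
  by exists m0 => //; apply: run_two_passes F1 E1 F2 E2.
split=> [_ j Hj|_ _ j Hj|]; first exact: pass1_holds.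
  apply: (@represents_holds p n al k L (mirror X) _ _ k0 HXm).
    by rewrite -npadn leq_add2l.
  by exists (npad n + j); exact: P2.
by rewrite (represents_accepting Rl) /algorithm3 ok1 n2 pass2_okE.
Qed.

Lemma run_mono M t s t' s' p al x tr m : t <= t' -> s <= s' ->
  run M t s p al x tr m -> run M t' s' p al x tr m.
Proof.
move=> Ht Hs [m0 E Hr]; exists m0; first exact: exec_within_mono E.
have feed_mono c m1 w ms : feed t s c m1 w ms -> feed t' s' c m1 w ms.
  by elim=> *; econstructor; eauto using exec_within_mono.
elim: Hr => *; econstructor; eauto using exec_within_mono.
Qed.

Lemma levels_le_bits n : 1 < n -> levels n <= bits n.
Proof.
move=> n1; have /andP[lo _] := levels_bounds n1.
have : (levels n).-1 < bits n.
  by rewrite -(ltn_exp2l _ _ (ltnSn 1)) (ltn_trans lo) // ltn_bits.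
by case: levels.
Qed.

Lemma word_bound_bits p n al : 1 < n -> al < p ->
  word_bound p n al (levels n) (bits p + bits n + 3).
Proof.
move=> n1 Hal; rewrite /word_bound Hal /=.
have := levels_le_bits n1 => Hk.
have exp_le v e : bits v <= e -> v < 2 ^ e.
  by move=> He; apply: leq_trans (ltn_bits v) _; rewrite leq_exp2l.
by rewrite !exp_le ?andbT //=; lia.
Qed.

(** With [b = bits n], a letter takes O(b) steps of cost O(b ^ 2), and the memory has O(b) cells of
    O(b) bits. The numerals absorb additive constants, as in [22 + 3 * k <= 25 * b]. *)
Lemma resource_bounds K N b L k : 10 <= K -> 1 < b -> L <= (N + 7) * b -> k <= b ->
  pass_time K L k <= 16 * (K.*2).+1 * (N + 7) ^ 2 * b ^ 3 /\
  run_space K L k <= K.+1 * (N + 7) * (25 + K) * b ^ 2.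
Proof.
move=> HK b1 HL Hk; split.
  have -> : pass_time K L k = (k.+2.*2 + 9) * ((K.*2).+1 * L ^ 2).
    by rewrite /pass_time /letter_time /step_time -mulSn; congr (_ * _); lia.
  have -> : 16 * (K.*2).+1 * (N + 7) ^ 2 * b ^ 3 = (16 * b) * ((K.*2).+1 * ((N + 7) * b) ^ 2).
    by rewrite expnMn [b ^ 3]expnS; ring.
  by rewrite leq_mul ?leq_mul ?leq_exp2r //; lia.
have -> : K.+1 * (N + 7) * (25 + K) * b ^ 2 = (K.+1 * ((N + 7) * b)) * ((25 + K) * b) by ring.
by rewrite /run_space /Qsize !leq_mul //; nia.
Qed.

(** * Asymptotics and probabilities *)

Local Open Scope classical_set_scope.
Local Open Scope ring_scope.

(** For [n = 0] the interval for [p] is empty, and for [n = 1] it contains no prime. *)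
Lemma good_modulus_size (R : realType) (c : R) (n p : nat) : 1 <= c ->
  good_modulus c n p -> (1 < n)%N.
Proof.
move=> c1 [pp /andP[H1 H2]]; case: n H1 H2 => [|[|n]] //.
  by rewrite powR0 ?mulr0 ?ltrn0 // gt_eqF //; lra.
rewrite powR1 mulr1 => _; rewrite ltr_nat; have := prime_gt1 pp; lia.
Qed.

Lemma Prob_complete (R : realType) (c : R) (hc : 1 <= c) x p :
  good_modulus c (size x) p -> dyck2 x -> Prob R p (fun alpha => algorithm3 p alpha x) = 1.
Proof.
move=> Hp Hx; have n1 := good_modulus_size hc Hp; case: Hp => pp _.
rewrite /Prob (_ : [set alpha : 'I_p | _]%SET = [set: 'I_p]%SET).
  by rewrite cardsT card_ord divff // pnatr_eq0 -lt0n prime_gt0.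
by apply/setP => a; rewrite !inE algorithm3_complete.
Qed.

Lemma Prob_sound (R : realType) (c : R) (hc : 1 <= c) x p :
  good_modulus c (size x) p -> ~ dyck2 x ->
  1 - (size x)%:R `^ (- c) <= Prob R p (fun alpha => ~~ algorithm3 p alpha x).
Proof.
move=> Hp Hx; have n1 := good_modulus_size hc Hp; case: Hp => pp /andP[Hp _].
have p0 : 0 < p%:R :> R by rewrite ltr0n prime_gt0.
have n0 : 0 < (size x)%:R :> R by rewrite ltr0n ltnW.
have := card_algorithm3 pp n1 Hx; set A := [set _ | _]%SET => HA.
rewrite /Prob (_ : [set alpha : 'I_p | _]%SET = ~: A)%SET; last first.
  by apply/setP => a; rewrite !inE.
have := cardsC A; rewrite card_ord => /(congr1 (fun m => m%:R : R)); rewrite natrD => HC.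
have {HC} -> : #|~: A|%:R = p%:R - #|A|%:R :> R by rewrite -HC addrC addKr.
rewrite mulrBl divff ?gt_eqF // lerD2l lerN2 ler_pdivrMr //.
(* At most [n] residues accept, and [p >= n ^ (1 + c)] gives [n <= n ^ (- c) * p]. *)
rewrite (le_trans (_ : _ <= (size x)%:R)) ?ler_nat //.
rewrite powRN -ler_pdivrMl ?invr_gt0 ?powR_gt0 // invrK.
apply: le_trans Hp; rewrite powRD ?powRr1 ?(ltW n0) //; last by rewrite (gt_eqF n0) implybT.
by rewrite mulrC.
Qed.

(** A natural number above [1 + c] replaces the real exponent, so [p] is less than [2 * n ^ N]. *)
Lemma bits_good_modulus (R : realType) (c : R) : 1 <= c ->
  exists N : nat, forall n p, good_modulus c n p -> (bits p <= N * bits n + 2)%N.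
Proof.
move=> c1; exists (Num.bound (1 + c)) => n p Hg.
have n1 := good_modulus_size c1 Hg; case: Hg => pp /andP[_ Hp].
set N := Num.bound _.
have c0 : 0 <= 1 + c by lra.
have : p%:R < (2 * n ^ N)%:R :> R.
  apply: lt_le_trans Hp _; rewrite natrM ler_wpM2l // natrX -powR_mulrn ?ler0n //.
  by apply: ler_powR; [rewrite ler1n ltnW | exact/ltW/archi_boundP].
rewrite ltr_nat => Hlt; apply: bits_le; first by rewrite addn2.
apply: (leq_trans Hlt); rewrite addn2 expnS leq_mul2l /=.
apply: (@leq_trans (2 ^ (N * bits n))%N); last by rewrite leq_exp2l.
by rewrite mulnC expnM; case: (N) => // N'; rewrite leq_exp2r // ltnW // ltn_bits.
Qed.

Lemma bits_log2 (R : realType) n : (1 < n)%N -> (bits n)%:R <= 2 * log2 R n.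
Proof.
move=> n1; have n0 : 0 < n%:R :> R by rewrite ltr0n ltnW.
have l2 : 0 < ln 2 :> R by rewrite ln_gt0 // ltr1n.
have : (trunc_log 2 n)%:R <= log2 R n.
  rewrite /log2 ler_pdivlMr // mulr_natl -lnXn // ler_ln ?posrE ?exprn_gt0 //.
  by rewrite -natrX ler_nat trunc_logP // ltnW.
have : 1 <= log2 R n by rewrite /log2 ler_pdivlMr // mul1r ler_ln ?posrE // ler_nat.
rewrite /bits -natr1; lra.
Qed.

Lemma bits_bigO (R : realType) (C e : nat) :
  (fun n : nat => (C * bits n ^ e)%:R : R) =O_\oo (fun n : nat => log2 R n ^+ e).
Proof.
apply/eqO_exP; exists (C.+1%:R * 2 ^+ e); first by rewrite mulr_gt0 ?ltr0n ?exprn_gt0.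
near=> n; have n1 : (1 < n)%N by near: n; exact: nbhs_infty_gt.
rewrite ger0_norm ?ler0n // normrX ger0_norm; last first.
  have := @bits_log2 R n n1; have : 0 <= (bits n)%:R :> R by []; lra.
rewrite -mulrA -exprMn natrM natrX ler_pM ?exprn_ge0 // ?ler_nat //.
by rewrite lerXn2r ?nnegrE ?bits_log2 // (le_trans _ (bits_log2 R n1)).
Unshelve. all: by end_near. Qed.

Theorem theorem2 (R : realType) (c : R) (hc : 1 <= c) :
  (exists (M : streaming_program) (s t : nat -> nat) (d : nat),
     [/\ streaming_algorithm [:: LeftToRight; RightToLeft] (good_modulus c) M s t,
         implements_algorithm3 (good_modulus c) M,
         (fun n : nat => (s n)%:R : R) =O_\oo (fun n : nat => log2 R n ^+ 2) &
         (fun n : nat => (t n)%:R : R) =O_\oo (fun n : nat => log2 R n ^+ d)]) /\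
  (forall (x : word) (p : nat), good_modulus c (size x) p ->
     (dyck2 x -> Prob R p (fun alpha => algorithm3 p alpha x) = 1) /\
     (~ dyck2 x ->
        Prob R p (fun alpha => ~~ algorithm3 p alpha x)
        >= 1 - (size x)%:R `^ (- c))).
Proof.
split; last by move=> x p Hp; split; [exact: Prob_complete Hp | exact: Prob_sound Hp].
have [K [HK HC]] := all_cheap_exists; have [N HN] := bits_good_modulus hc.
set Ct := (16 * (K.*2).+1 * (N + 7) ^ 2)%N; set Cs := (K.+1 * (N + 7) * (25 + K))%N.
have runs x p al : good_modulus c (size x) p -> (al < p)%N -> exists tr m',
    run program (Ct * bits (size x) ^ 3) (Cs * bits (size x) ^ 2) p al x tr m' /\
    run_spec p al x tr m'.
  move=> Hg Hal; have n1 := good_modulus_size hc Hg; have [pp _] := Hg.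
  have [tr [m' [Hr Hs]]] := run_program n1 pp (word_bound_bits n1 Hal) HK HC.
  exists tr, m'; split=> //.
  have b1 : (1 < bits (size x))%N by rewrite ltnS trunc_log_gt0.
  have HL : (bits p + bits (size x) + 3 <= (N + 7) * bits (size x))%N.
    by have := HN _ _ Hg; nia.
  have [Ht Hsp] := resource_bounds HK b1 HL (levels_le_bits n1).
  exact: run_mono Hr.
exists program, (fun n => Cs * bits n ^ 2)%N, (fun n => Ct * bits n ^ 3)%N, 3%N; split.
- by split=> // x p al Hg Hal; have [tr [m' [Hr _]]] := runs x p al Hg Hal; exists tr, m'.
- move=> x p al t s tr m' Hg Hal Hr.
  have [tr' [m2 [Hr' Hs]]] := runs x p al Hg Hal.
  (* The given run, whatever its bounds, is the one constructed above. *)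
  by have [-> ->] := run_det Hr Hr'.
- exact: bits_bigO.
- exact: bits_bigO.
Qed.
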